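(* Let $d$ be a nonzero integer and let $X_d\subset\mathbb{P}^4_{\mathbb{Q}}$ be the surface defined by the vanishing of $Q_0 = d(u_0^2 - 3u_1^2) + 6u_2^2 + 6u_2u_3 - 6u_3u_4$ and $Q_\infty = -2du_0u_1 + u_2^2 - 2u_2u_4 - 3u_3^2 - u_4^2$. Let $\zeta$ be a root of $T^3+3T^2+3T-9$. Suppose that (i) $d\equiv 5 \pmod{12}$, and (ii) for every prime $v$ dividing $d$, the element $\zeta$ is a square in $\mathbb{Q}_v\otimes_{\mathbb{Q}}\mathbb{Q}(\zeta)$. Then no quadric hypersurface in $\mathbb{P}^4_{\mathbb{Q}}$ containing $X_d$ contains a line defined over $\mathbb{Q}$.
   Context: $u_0,\dots,u_4$ are coordinates on $\mathbb{P}^4$. *)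

(* Defs.v *)
From HB Require Import structures.
From mathcomp Require Import all_boot all_order all_algebra all_field.
From mathcomp Require Import boolp mpoly.

Set Implicit Arguments.
Unset Strict Implicit.
Unset Printing Implicit Defensive.

Import GRing.Theory.

Record prime_nat := PrimeNat { prime_val :> nat; prime_valP : prime prime_val }.

(* Z_p as the inverse limit of the Z / p ^ n; the n-th component is the
   representative in [0, p ^ n[ of the residue mod p ^ n. *)
Record padic_int (p : prime_nat) := PadicInt {
  residue :> nat -> nat;
  residueP : forall n, residue n.+1 %% p ^ n = residue n
}.

Section PadicInt.
Variable p : prime_nat.
Implicit Types (x y z : padic_int p) (f : nat -> nat).

HB.instance Definition _ := gen_eqMixin (padic_int p).
HB.instance Definition _ := gen_choiceMixin (padic_int p).

Lemma prime_nat_gt0 n : 0 < p ^ n.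
Proof. by rewrite expn_gt0 prime_gt0 // prime_valP. Qed.

Lemma residue_inj x y : (forall n, x n = y n) -> x = y.
Proof.
case: x y => [f fP] [g gP] /= /funext fg; subst g.
by congr PadicInt; apply: Prop_irrelevance.
Qed.

Lemma residue_small x n : x n %% p ^ n = x n.
Proof. by rewrite -{1}(residueP x n) modn_mod residueP. Qed.

Lemma residue_mod x m n : m <= n -> x n %% p ^ m = x m.
Proof.
move=> /subnK <-; elim: (n - m) => [|k IH]; first exact: residue_small.
by rewrite -IH addSn -(residueP x (k + m)) modn_dvdm ?dvdn_exp2l ?leq_addl.
Qed.

Definition padic_of f (fP : forall n, f n.+1 = f n %[mod p ^ n]) : padic_int p.
Proof.
refine (@PadicInt p (fun n => f n %% p ^ n) _) => n.
by rewrite modn_dvdm ?fP // dvdn_exp2l.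
Defined.

Fact padic_const_coherent (a n : nat) : a = a %[mod p ^ n].
Proof. by []. Qed.

Fact padic_add_coherent x y n : x n.+1 + y n.+1 = x n + y n %[mod p ^ n].
Proof. by rewrite -modnDm !residueP. Qed.

Fact padic_mul_coherent x y n : x n.+1 * y n.+1 = x n * y n %[mod p ^ n].
Proof. by rewrite -modnMm !residueP. Qed.

Lemma residue_le x n : x n <= p ^ n.
Proof. by rewrite -residue_small ltnW // ltn_pmod ?prime_nat_gt0. Qed.

Fact padic_opp_coherent x n :
  p ^ n.+1 - x n.+1 = p ^ n - x n %[mod p ^ n].
Proof.
apply/eqP; rewrite -(eqn_modDl (x n)) subnKC ?residue_le //.
rewrite -[X in X + _ == _ %[mod _]](residueP x) modnDml.
by rewrite subnKC ?residue_le // modnn expnS modnMl.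
Qed.

Definition padic0 := padic_of (padic_const_coherent 0).
Definition padic1 := padic_of (padic_const_coherent 1).
Definition padic_add x y := padic_of (padic_add_coherent x y).
Definition padic_mul x y := padic_of (padic_mul_coherent x y).
Definition padic_opp x := padic_of (padic_opp_coherent x).

Fact padic_addA : associative padic_add.
Proof.
by move=> x y z; apply: residue_inj => n /=; rewrite modnDmr modnDml addnA.
Qed.

Fact padic_addC : commutative padic_add.
Proof. by move=> x y; apply: residue_inj => n /=; rewrite addnC. Qed.

Fact padic_add0 : left_id padic0 padic_add.
Proof.
by move=> x; apply: residue_inj => n /=; rewrite mod0n add0n residue_small.
Qed.

Fact padic_addN : left_inverse padic0 padic_opp padic_add.
Proof.
move=> x; apply: residue_inj => n /=.
by rewrite modnDml subnK ?residue_le // modnn mod0n.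
Qed.

HB.instance Definition _ := GRing.isZmodule.Build (padic_int p)
  padic_addA padic_addC padic_add0 padic_addN.

Fact padic_mulA : associative padic_mul.
Proof.
by move=> x y z; apply: residue_inj => n /=; rewrite modnMmr modnMml mulnA.
Qed.

Fact padic_mulC : commutative padic_mul.
Proof. by move=> x y; apply: residue_inj => n /=; rewrite mulnC. Qed.

Fact padic_mul1 : left_id padic1 padic_mul.
Proof.
by move=> x; apply: residue_inj => n /=; rewrite modnMml mul1n residue_small.
Qed.

Fact padic_mulD : left_distributive padic_mul padic_add.
Proof.
move=> x y z; apply: residue_inj => n /=.
by rewrite modnMml modnDm mulnDl.
Qed.

Fact padic1_neq0 : padic1 != 0%R.
Proof.
apply/eqP => /(congr1 (fun x => residue x 1)) /=.
by rewrite mod0n modn_small // expn1 prime_gt1 // prime_valP.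
Qed.

HB.instance Definition _ := GRing.Zmodule_isComNzRing.Build (padic_int p)
  padic_mulA padic_mulC padic_mul1 padic_mulD padic1_neq0.

Local Open Scope ring_scope.

Definition padic_unit : pred (padic_int p) := fun x => `[< exists y, y * x = 1 >].
Definition padic_inv x : padic_int p :=
  if pselect (exists y, y * x = 1) is left ex then projT1 (cid ex) else x.

Fact padic_mulV : {in padic_unit, left_inverse 1 padic_inv *%R}.
Proof.
move=> x /asboolP ex; rewrite /padic_inv.
by case: pselect => // {}ex; case: cid.
Qed.

Fact padic_unitPl x y : y * x = 1 -> padic_unit x.
Proof. by move=> xy; apply/asboolP; exists y. Qed.

Fact padic_inv_out : {in [predC padic_unit], padic_inv =1 id}.
Proof.
by move=> x; rewrite inE => /asboolP nex; rewrite /padic_inv; case: pselect.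
Qed.

HB.instance Definition _ := GRing.ComNzRing_hasMulInverse.Build (padic_int p)
  padic_mulV padic_unitPl padic_inv_out.

Fact padic_integral : GRing.integral_domain_axiom (padic_int p).
Proof.
move=> x y xy0; have {}xy0 n : (p ^ n %| x n * y n)%N.
  by rewrite /dvdn; move/(congr1 (fun z => residue z n)): xy0 => /= ->; rewrite mod0n.
apply: contraPT isT; rewrite negb_or => /andP[/eqP x0 /eqP y0].
have nz z : z <> 0 -> exists n, z n != 0%N.
  move=> z0; apply/not_existsP => h; apply: z0; apply: residue_inj => n /=.
  by rewrite mod0n; apply/eqP/negPn/negP/h.
have [m xm] := nz _ x0; have [n yn] := nz _ y0; exfalso.
have nd z k l : (k <= l)%N -> z k != 0%N -> (0 < z l)%N && (logn p (z l) < k)%N.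
  move=> kl; rewrite -(residue_mod z kl) => zk.
  have zl : (0 < z l)%N by case: (z l) zk => //; rewrite mod0n.
  rewrite zl /= ltnNge -pfactor_dvdn ?prime_valP //.
have /andP[xp xl] := nd _ _ (m + n)%N (leq_addr _ _) xm.
have /andP[yp yl] := nd _ _ (m + n)%N (leq_addl _ _) yn.
have := xy0 (m + n)%N; rewrite pfactor_dvdn ?prime_valP ?muln_gt0 ?xp //.
rewrite lognM // => le; have := leq_trans le (leq_add (ltnW xl) (ltnW yl)).
by move: le; rewrite leqNgt (leq_trans _ (leq_add xl (ltnW yl))) // addSn.
Qed.

HB.instance Definition _ := GRing.ComUnitRing_isIntegral.Build (padic_int p)
  padic_integral.

End PadicInt.

Notation padic p := {fraction padic_int p}.
Local Open Scope ring_scope.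

Lemma padic_natr_eq0 (p : prime_nat) n : (n%:R == 0 :> padic p) = (n == 0)%N.
Proof.
have resn m k : residue (k%:R : padic_int p) m = (k %% p ^ m)%N.
  elim: k => [|k IH]; first by [].
  by rewrite -natr1 /= IH modnDml modnDmr addn1.
rewrite -(rmorph_nat (@tofrac (padic_int p))) tofrac_eq0.
apply/eqP/eqP => [/(congr1 (fun x => residue x n)) | -> //].
by rewrite resn /= mod0n modn_small // ltn_expl // prime_gt1 // prime_valP.
Qed.

Definition padic_of_rat (p : prime_nat) : rat -> padic p := @ratr (padic p).

Section RatPadic.
Variable p : prime_nat.

Fact padic_intr_denq_neq0 x : (denq x)%:~R != 0 :> padic p.
Proof. by rewrite -absz_denq -pmulrn padic_natr_eq0 absz_eq0 denq_neq0. Qed.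

Fact padic_of_rat_zmod : zmod_morphism (@padic_of_rat p).
Proof.
have injZtoQ: @injective rat int intr by apply: intr_inj.
have nz_den := padic_intr_denq_neq0; rewrite /padic_of_rat /ratr => x y.
apply: (canLR (mulfK (nz_den _))); apply: (mulIf (nz_den x)).
rewrite mulrAC mulrBl divfK ?nz_den // mulrAC -!rmorphM.
apply: (mulIf (nz_den y)); rewrite mulrAC mulrBl divfK ?nz_den //.
rewrite -!(rmorphM, rmorphB); congr _%:~R; apply: injZtoQ.
rewrite !(rmorphM, rmorphB) /= [_ - _]lock /= -lock !numqE.
by rewrite (mulrAC y) -!mulrBl -mulrA mulrAC !mulrA.
Qed.

Fact padic_of_rat_monoid : monoid_morphism (@padic_of_rat p).
Proof.
have injZtoQ: @injective rat int intr by apply: intr_inj.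
have nz_den := padic_intr_denq_neq0; rewrite /padic_of_rat.
split=> [|x y]; first by rewrite /ratr divr1.
rewrite /ratr mulrC mulrAC; apply: canLR (mulKf (nz_den _)) _; rewrite !mulrA.
do 2!apply: canRL (mulfK (nz_den _)) _; rewrite -!rmorphM; congr _%:~R.
apply: injZtoQ; rewrite !rmorphM [x * y]lock /= !numqE -lock.
by rewrite -!mulrA mulrA mulrCA -!mulrA (mulrCA y).
Qed.

HB.instance Definition _ := GRing.isZmodMorphism.Build rat (padic p)
  (@padic_of_rat p) padic_of_rat_zmod.
HB.instance Definition _ := GRing.isMonoidMorphism.Build rat (padic p)
  (@padic_of_rat p) padic_of_rat_monoid.

End RatPadic.

(* The K-algebra K (x)_F L of a finite extension L / F, for iota : F -> K: a
   tensor sum_i c_i (x) e_i is stored as its row (c_i)_i of coordinates on the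
   basis (1 (x) e_i)_i, where (e_i)_i = vbasis {:L}. *)
Definition tensor (F K : fieldType) (iota : {rmorphism F -> K})
  (L : fieldExtType F) := 'rV[K]_(\dim {:L}).

Section Tensor.
Variables (F K : fieldType) (iota : {rmorphism F -> K}) (L : fieldExtType F).
Local Notation T := (tensor iota L).
Local Notation e := (vbasis {:L}).
Implicit Types (a b : K) (x y : L) (u v w : T).

HB.instance Definition _ := GRing.Zmodule.on T.

Definition tens a x : T := \row_k (a * iota (coord e k x)).

Definition tensor_mul u v : T :=
  \sum_i \sum_j tens (u 0 i * v 0 j) (e`_i * e`_j).

Lemma tensDl a b x : tens (a + b) x = tens a x + tens b x.
Proof. by apply/rowP=> k; rewrite !mxE mulrDl. Qed.

Lemma tensDr a x y : tens a (x + y) = tens a x + tens a y.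
Proof. by apply/rowP=> k; rewrite !mxE linearD rmorphD mulrDr. Qed.

Lemma tens0l x : tens 0 x = 0.
Proof. by apply/rowP=> k; rewrite !mxE mul0r. Qed.

Lemma tens0r a : tens a 0 = 0.
Proof. by apply/rowP=> k; rewrite !mxE linear0 rmorph0 mulr0. Qed.

Lemma tens_suml I (r : seq I) (P : pred I) (f : I -> K) x :
  tens (\sum_(i <- r | P i) f i) x = \sum_(i <- r | P i) tens (f i) x.
Proof. by apply: (big_morph (tens^~ x)) => [a b|]; rewrite ?tensDl ?tens0l. Qed.

Lemma tens_sumr I (r : seq I) (P : pred I) a (f : I -> L) :
  tens a (\sum_(i <- r | P i) f i) = \sum_(i <- r | P i) tens a (f i).
Proof. by apply: (big_morph (tens a)) => [x y|]; rewrite ?tensDr ?tens0r. Qed.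

Lemma tensZ a (c : F) x : tens a (c *: x) = tens (a * iota c) x.
Proof. by apply/rowP=> k; rewrite !mxE linearZ /= rmorphM mulrA. Qed.

Lemma tensor_sum u : u = \sum_i tens (u 0 i) e`_i.
Proof.
apply/rowP=> k; rewrite summxE (bigD1 k) //= big1 => [|i nik].
  by rewrite addr0 mxE coord_free ?(basis_free (vbasisP _)) // eqxx rmorph1 mulr1.
rewrite mxE coord_free ?(basis_free (vbasisP _)) // (negPf nik).
by rewrite rmorph0 mulr0.
Qed.

Lemma tensor_mulDl : left_distributive tensor_mul +%R.
Proof.
move=> u v w; rewrite -big_split; apply: eq_bigr => i _.
by rewrite -big_split; apply: eq_bigr => j _; rewrite mxE mulrDl tensDl.
Qed.

Lemma tensor_mulC : commutative tensor_mul.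
Proof.
move=> u v; rewrite /tensor_mul exchange_big; apply: eq_bigr => i _ /=.
by apply: eq_bigr => j _; rewrite mulrC [e`_j * _]mulrC.
Qed.

Lemma tensor_mulDr : right_distributive tensor_mul +%R.
Proof. by move=> u v w; rewrite tensor_mulC tensor_mulDl ![tensor_mul _ u]tensor_mulC. Qed.

Lemma tens_mul a b x y : tensor_mul (tens a x) (tens b y) = tens (a * b) (x * y).
Proof.
rewrite [in RHS](coord_vbasis (memvf x)) [in RHS](coord_vbasis (memvf y)).
rewrite mulr_suml tens_sumr; apply: eq_bigr => i _.
rewrite mulr_sumr tens_sumr; apply: eq_bigr => j _.
by rewrite !mxE -scalerAl -scalerAr !tensZ mulrACA mulrA.
Qed.

Lemma tensor_ind (P : T -> Prop) :
  P 0 -> (forall u v, P u -> P v -> P (u + v)) -> (forall a x, P (tens a x)) ->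
  forall u, P u.
Proof. by move=> P0 PD Pt u; rewrite [u]tensor_sum; apply: big_ind. Qed.

Lemma tensor_mul0 u : tensor_mul 0 u = 0.
Proof.
by apply: (@addrI _ (tensor_mul 0 u)); rewrite -tensor_mulDl !addr0.
Qed.

Fact tensor_mulA : associative tensor_mul.
Proof.
move=> u v w; elim/tensor_ind: u => [|u u' IH IH'|a x].
- by rewrite !tensor_mul0.
- by rewrite !tensor_mulDl IH IH'.
elim/tensor_ind: v => [|v v' IH IH'|b y].
- by rewrite tensor_mul0 ![tensor_mul (tens _ _) 0]tensor_mulC !tensor_mul0.
- by rewrite tensor_mulDl !tensor_mulDr tensor_mulDl IH IH'.
elim/tensor_ind: w => [|w w' IH IH'|c z].
- by rewrite ![tensor_mul _ 0]tensor_mulC !tensor_mul0 tensor_mulC tensor_mul0.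
- by rewrite !tensor_mulDr IH IH'.
by rewrite !tens_mul !mulrA.
Qed.

Fact tensor_mul1 : left_id (tens 1 1) tensor_mul.
Proof.
move=> u; elim/tensor_ind: u => [|u u' IH IH'|a x].
- by rewrite tensor_mulC tensor_mul0.
- by rewrite tensor_mulDr IH IH'.
by rewrite tens_mul !mul1r.
Qed.

Fact tensor1_neq0 : tens 1 1 != 0.
Proof.
apply/eqP => /rowP h; have := oner_neq0 L; rewrite (coord_vbasis (memvf 1)).
rewrite big1 ?eqxx // => i _; have := h i; rewrite !mxE mul1r.
by move/eqP; rewrite fmorph_eq0 => /eqP ->; rewrite scale0r.
Qed.

HB.instance Definition _ := GRing.Zmodule_isComNzRing.Build T
  tensor_mulA tensor_mulC tensor_mul1 tensor_mulDl tensor1_neq0.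

End Tensor.

Definition u (i : nat) : {mpoly rat[5]} := 'X_(inord i).

Definition Q0 (d : int) : {mpoly rat[5]} :=
  d%:~R * (u 0 ^+ 2 - 3%:R * u 1 ^+ 2)
  + 6%:R * u 2 ^+ 2 + 6%:R * u 2 * u 3 - 6%:R * u 3 * u 4.

Definition Qinf (d : int) : {mpoly rat[5]} :=
  - 2%:R * d%:~R * u 0 * u 1
  + u 2 ^+ 2 - 2%:R * u 2 * u 4 - 3%:R * u 3 ^+ 2 - u 4 ^+ 2.

(* Closed subsets of P^4_Q are given by their geometric points, in homogeneous
   coordinates over the algebraic closure algC of Q. *)
Definition vanishes_at (q : {mpoly rat[5]}) (x : 'rV[algC]_5) : Prop :=
  (map_mpoly ratr q).@[fun i => x 0 i] = 0.

Definition in_X (d : int) (x : 'rV[algC]_5) : Prop :=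
  [/\ x != 0, vanishes_at (Q0 d) x & vanishes_at (Qinf d) x].

Definition is_quadric (q : {mpoly rat[5]}) : Prop := q != 0 /\ q \is 2.-homog.

Definition in_quadric (q : {mpoly rat[5]}) (x : 'rV[algC]_5) : Prop :=
  x != 0 /\ vanishes_at q x.

Definition is_line (l : 'M[rat]_(2, 5)) : Prop := \rank l = 2%N.

Definition in_line (l : 'M[rat]_(2, 5)) (x : 'rV[algC]_5) : Prop :=
  x != 0 /\ (x <= map_mx ratr l)%MS.

(* Main.v *)
Require Import Defs.
From HB Require Import structures.
From mathcomp Require Import all_boot all_order all_algebra all_field.
From mathcomp Require Import boolp mpoly zify ring generic_quotient.

Set Implicit Arguments.
Unset Strict Implicit.
Unset Printing Implicit Defensive.

Import Order.TTheory GRing.Theory Num.Theory.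
Local Open Scope ring_scope.

(* A quadric containing X_d is a member s Q_0 + t Q_inf of the pencil, with s, t
   coprime integers; put g = t^2 + 3 s^2, so that the binary part of the form is
   d s <1, - g>.  Suppose that it contains a rational line.
   - Modulo 3 the form has rank 4 and Witt index 1 unless 3 | t; hence 3 | t, so
     v_3(g) = 1 and the Hilbert symbol (g, d)_3 is (d / 3) = -1.
   - If p does not divide 6 d and v_p(g) is odd, then modulo p the form has rank 4
     and discriminant d times a square.  It contains a plane, so d is a square mod p
     and (g, d)_p = 1.
   - If p divides d, a square root of zeta provides a line of X_1 over Q_p.  This line
     and the given one have a common projection to the coordinates (u2, u3, u4), which
     shows that d is a norm from Q_p(sqrt g), that is (g, d)_p = 1.
   - As d = 1 mod 4, g > 0 and v_2(g) is even, the places 2 and infinity do not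
     contribute, and the product formula, i.e. quadratic reciprocity, fails. *)

(** * Quadratic reciprocity *)

(** The polynomial of zeta is (T + 1)^3 - 10. Its homogenisation t^3 + 3 t^2 s + 3 t s^2 - 9 s^3 is,
    up to the factor 6, the discriminant of the part of s Q_0 + t Q_inf in u2, u3, u4, so zeta is a
    value of t / s at which this ternary part is singular. The primes p dividing d are the obstacle:
    the part in u0, u1 vanishes modulo p, and a determinant modulo p says nothing about d. But X_d
    and X_1 have the same ternary part, and their binary parts differ by the factor d. Points of the
    two planes with the same (u2, u3, u4) therefore have binary values whose ratio is d, and s times
    such a value is a norm from Q_p(sqrt g). Hypothesis (ii) serves to produce the plane for X_1. No
    symbol at 2 is ever defined. For an odd prime q, reciprocity turns the product of (q, d)_p over
    the odd p into the character mod 4 of d to the power (q - 1) / 2, which is 1 as d = 1 mod 4. A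
    factor 2 of g would not be harmless when d = 5 mod 8, but g contains it 0 or 2 times. *)

Definition legendre (p : nat) (a : int) : int :=
  if (a%:~R : 'F_p) ^+ p./2 == 1 then 1 else -1.

Lemma sum_leq_divn (n m p : nat) : (0 < p)%N -> (m %/ p <= n)%N ->
  (\sum_(j < n) (p * j.+1 <= m) = m %/ p)%N.
Proof.
move=> p0 mn; under eq_bigr => j _ do rewrite mulnC -leq_divRL //.
elim: n (m %/ p)%N mn => [|n IH] k kn; first by rewrite big_ord0; lia.
case: k kn => [|k] kn; first by rewrite big1.
rewrite big_ord_recl /= add1n; congr _.+1.
by rewrite -[RHS](IH k) //; apply: eq_bigr => i _.
Qed.

(* Eisenstein's count of the lattice points of a rectangle on both sides of its
   diagonal. *)
Lemma sum_divn_reciprocity (p q : nat) :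
    prime p -> prime q -> odd p -> odd q -> p != q ->
  (\sum_(i < p./2) (q * i.+1) %/ p + \sum_(j < q./2) (p * j.+1) %/ q
     = p./2 * q./2)%N.
Proof.
move=> p_pr q_pr p_odd q_odd pq.
have p0 := prime_gt0 p_pr; have q0 := prime_gt0 q_pr.
have bnd a b i : odd a -> odd b -> (i < a./2)%N -> ((b * i.+1) %/ a <= b./2)%N.
  move=> ao bo ih; rewrite -ltnS ltn_divLR; last by lia.
  have ea : (a = a./2.*2.+1)%N by lia.
  have eb : (b = b./2.*2.+1)%N by lia.
  by move: (a./2) (b./2) ea eb ih => x y -> -> ih; nia.
under eq_bigr => i _ do rewrite -(@sum_leq_divn q./2) ?bnd //.
under [X in (_ + X)%N]eq_bigr => i _ do rewrite -(@sum_leq_divn p./2) ?bnd //.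
rewrite exchange_big /= -big_split /=.
under eq_bigr => j _.
  rewrite -big_split /=.
  under eq_bigr => i _.
    have -> : ((p * j.+1 <= q * i.+1) + (q * i.+1 <= p * j.+1) = 1)%N.
      (* No lattice point lies on the diagonal: p would divide q or i + 1, which is below p. *)
      have : (p * j.+1 != q * i.+1)%N.
        apply/eqP => e; have : (p %| q * i.+1)%N by rewrite -e dvdn_mulr.
        rewrite Euclid_dvdM // dvdn_prime2 // (negPf pq) /= => /dvdn_leq.
        by have := ltn_ord i; lia.
      by case: ltngtP.
    over.
  rewrite sum1_card card_ord; over.
by rewrite sum_nat_const card_ord mulnC.
Qed.

Section Legendre.
Variable p : nat.
Hypotheses (p_pr : prime p) (p_odd : odd p).

Lemma Fp_natr_eq0 (n : nat) : (n%:R == 0 :> 'F_p) = (p %| n)%N.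
Proof. by rewrite -(dvdn_pcharf (pchar_Fp p_pr)). Qed.

Lemma Fp_intr_eq0 (a : int) : (a%:~R == 0 :> 'F_p) = (p%:Z %| a)%Z.
Proof.
rewrite dvdzE /=; case: a => n; first by rewrite -pmulrn Fp_natr_eq0.
by rewrite NegzE mulrNz oppr_eq0 -pmulrn Fp_natr_eq0.
Qed.

Lemma Fp_neg1_neq1 : (-1 : 'F_p) != 1.
Proof.
rewrite eq_sym -subr_eq0 opprK -[1 + 1]/(2%:R) Fp_natr_eq0 gtnNdvd //.
by have := prime_gt1 p_pr; case: p p_odd => [|[|[|]]].
Qed.

Lemma Fp_expr_half_sqr (a : 'F_p) : a != 0 -> (a ^+ p./2) ^+ 2 = 1.
Proof.
move=> a0; rewrite -exprM muln2.
have -> : p./2.*2 = p.-1 by lia.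
apply: (mulfI a0); rewrite -exprS mulr1.
have -> : (p.-1.+1 = p)%N by have := prime_gt0 p_pr; lia.
by have := expf_card a; rewrite card_Fp.
Qed.

Lemma Fp_expr_half (a : 'F_p) : a != 0 -> a ^+ p./2 = 1 \/ a ^+ p./2 = -1.
Proof. by move/Fp_expr_half_sqr/eqP; rewrite sqrf_eq1 => /orP[]/eqP; auto. Qed.

Lemma legendre_sign (a : int) n : a%:~R ^+ p./2 = (-1) ^+ n :> 'F_p ->
  legendre p a = (-1) ^+ n.
Proof.
rewrite /legendre => ->; rewrite -signr_odd -[RHS]signr_odd.
by case: (odd n); rewrite ?expr0 ?eqxx // expr1 (negPf Fp_neg1_neq1).
Qed.

(** Euler's criterion gives [legendre] the value -1, not 0, on multiples of p, so it is
    multiplicative on integers prime to p only; in return its square is always 1. *)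
Lemma legendreM (a b : int) : ~~ (p%:Z %| a)%Z -> ~~ (p%:Z %| b)%Z ->
  legendre p (a * b) = legendre p a * legendre p b.
Proof.
rewrite -!Fp_intr_eq0 => a0 b0; rewrite /legendre rmorphM exprMn /=.
have [-> | ->] := Fp_expr_half a0; have [-> | ->] := Fp_expr_half b0;
  by rewrite ?mul1r ?mulr1 ?mulrNN ?mulr1 ?eqxx ?(negPf Fp_neg1_neq1).
Qed.

Lemma legendre_sqr (a : int) (c : 'F_p) : ~~ (p%:Z %| a)%Z ->
  a%:~R = c ^+ 2 -> legendre p a = 1.
Proof.
rewrite -Fp_intr_eq0 /legendre => a0 e; rewrite e exprAC.
by rewrite Fp_expr_half_sqr ?eqxx //; apply: contraNneq a0 => c0; rewrite e c0 expr0n.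
Qed.

Lemma legendreN1 : legendre p (-1) = (-1) ^+ p./2.
Proof. by apply: legendre_sign; rewrite rmorphN1. Qed.

(* Gauss's lemma, with the number of sign changes replaced by a sum of the same
   parity. *)
Lemma expr_half_divn_sum (a : nat) : odd a -> ~~ (p %| a)%N ->
  a%:R ^+ p./2 = (-1) ^+ (\sum_(i < p./2) (a * i.+1) %/ p) :> 'F_p.
Proof.
move=> a_odd pa; set h := p./2.
have p0 := prime_gt0 p_pr.
have ep : p = h.*2.+1 by rewrite /h; lia.
pose r (i : nat) := ((a * i.+1) %% p)%N.
pose m (i : nat) := (if h < r i then p - r i else r i)%N.
have rlt i : (r i < p)%N by rewrite ltn_pmod.
have r0 (i : 'I_h) : (0 < r i)%N.
  rewrite lt0n; apply/negP; rewrite -/(dvdn p _) Euclid_dvdM // (negPf pa) /=.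
  by move/dvdn_leq; have := ltn_ord i; lia.
have mlt (i : 'I_h) : ((m i).-1 < h)%N.
  by rewrite /m; have := r0 i; have := rlt i; case: (ltnP h); lia.
have m0 (i : 'I_h) : (0 < m i)%N.
  by rewrite /m; have := r0 i; have := rlt i; case: (ltnP h); lia.
have rE i : (r i)%:R = a%:R * i.+1%:R :> 'F_p.
  by rewrite -natrM /r Fp_nat_mod.
have mE (i : 'I_h) : (m i)%:R = (-1) ^+ (h < r i)%N * (a%:R * i.+1%:R) :> 'F_p.
  rewrite -rE /m; case: ltnP => hr; last by rewrite mul1r.
  rewrite natrB ?(ltnW (rlt i)) //.
  have /eqP -> : p%:R == 0 :> 'F_p by rewrite Fp_natr_eq0.
  by rewrite sub0r expr1 mulN1r.
pose f i : 'I_h := Ordinal (mlt i).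
have f_inj : injective f.
  move=> i j /(congr1 val) /= e; have {e} : m i = m j.
    by have := m0 i; have := m0 j; lia.
  (* Squaring removes the signs. Then p divides (i - j) (i + j + 2), and both factors are smaller
     than p in absolute value. *)
  move/(congr1 (fun n => n%:R ^+ 2 : 'F_p)); rewrite !mE !exprMn !sqrr_sign !mul1r.
  move/mulfI.
  rewrite expf_eq0 /= Fp_natr_eq0 => /(_ pa) /eqP.
  rewrite -subr_eq0 subr_sqr mulf_eq0 -natrD Fp_natr_eq0 => /orP[|/dvdn_leq].
    wlog ij : i j / (j <= i)%N.
      move=> W; case: (leqP j i) => [|/ltnW]; first exact: W.
      by move=> /W; rewrite -opprB oppr_eq0 => WW /WW ->.
    rewrite -natrB ?ltnS // Fp_natr_eq0 => /dvdn_leq d.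
    by apply: val_inj => /=; have := ltn_ord i; have := ltn_ord j; lia.
  by have := ltn_ord i; have := ltn_ord j; lia.
have prodE : \prod_(i < h) (i.+1%:R : 'F_p) != 0.
  by apply/prodf_neq0 => i _; rewrite Fp_natr_eq0 gtnNdvd //; have := ltn_ord i; lia.
have signE : \prod_(i < h) (i.+1%:R : 'F_p)
   = (-1) ^+ (\sum_(i < h) (h < r i)%N) * (a%:R ^+ h * \prod_(i < h) (i.+1%:R : 'F_p)).
  rewrite {1}(reindex_inj f_inj) /=.
  under eq_bigr => i _ do rewrite prednK ?m0 // mE.
  rewrite big_split /= big_split /= prodr_const card_ord; congr (_ * _).
  by rewrite expr_sum.
have sumE : odd (\sum_(i < h) (h < r i)%N) = odd (\sum_(i < h) (a * i.+1) %/ p).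
  have e : (\sum_(i < h) i.+1 = \sum_(i < h) m i)%N.
    by rewrite (reindex_inj f_inj); apply: eq_bigr => i _ /=; rewrite prednK.
  (* Each summand is even: as a and p are odd, i + 1 is the quotient plus [r i] modulo 2, and [r i]
     is [m i] plus the sign indicator. Since [m] permutes 1, ..., h, the first and third terms have
     equal sums. *)
  have : odd (\sum_(i < h) (i.+1 + (a * i.+1) %/ p + m i + (h < r i))) = false.
    elim/big_ind: _ => // [x y|i _]; first by rewrite oddD => -> ->.
    have := divn_eq (a * i.+1) p; rewrite -/(r i) => /(congr1 odd).
    rewrite !oddD !oddM a_odd p_odd /= andbT => ->.
    rewrite /m; case: ltnP => hr; last by case: odd; case: odd.
    by rewrite oddB ?(ltnW (rlt i)) // p_odd; case: odd; case: odd.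
  rewrite !big_split /= -e !oddD; by case: odd; case: odd; case: odd.
rewrite -signr_odd -sumE signr_odd.
apply: (mulIf prodE); rewrite {2}signE mulrA -exprD addnn -mul2n exprM.
by rewrite sqrrN expr1n expr1n mul1r.
Qed.
End Legendre.

Lemma quadratic_reciprocity (p q : nat) :
    prime p -> prime q -> odd p -> odd q -> p != q ->
  legendre p q * legendre q p = (-1) ^+ (p./2 * q./2).
Proof.
move=> p_pr q_pr p_odd q_odd pq.
rewrite -(sum_divn_reciprocity p_pr q_pr p_odd q_odd pq) exprD; congr (_ * _).
  by apply: legendre_sign => //; rewrite -pmulrn expr_half_divn_sum // dvdn_prime2.
by apply: legendre_sign => //; rewrite -pmulrn expr_half_divn_sum // dvdn_prime2 // eq_sym.
Qed.

(** * Hilbert symbols *)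

Definition valz (p : nat) (a : int) : nat := logn p `|a|%N.
Definition unit_part (p : nat) (a : int) : int := (a %/ (p ^ valz p a)%:Z)%Z.

(* The Hilbert symbol (a, b)_p of Q_p, for p odd. *)
Definition hilbert (p : nat) (a b : int) : int :=
  legendre p (-1) ^+ (valz p a * valz p b)
  * legendre p (unit_part p a) ^+ valz p b * legendre p (unit_part p b) ^+ valz p a.

(** N only makes the product finite: for nonzero a and b below N in absolute value, the primes from
    N on contribute 1. *)
Definition odd_hilbert_prod (N : nat) (a b : int) : int :=
  \prod_(p < N | prime p && odd p) hilbert p a b.

Section LocalSymbol.
Variable p : nat.
Hypotheses (p_pr : prime p).

Lemma unit_part_valzE a : a = unit_part p a * (p ^ valz p a)%:Z.
Proof. by rewrite divzK // dvdzE /= pfactor_dvdnn. Qed.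

Lemma pexpz_neq0 n : (p ^ n)%:Z != 0.
Proof. by rewrite eqz_nat -lt0n expn_gt0 prime_gt0. Qed.

Lemma unit_part_ndvd a : a != 0 -> ~~ (p%:Z %| unit_part p a)%Z.
Proof.
move=> a0; rewrite dvdzE /=; apply/negP => /dvdnP[k ek].
have : (`|a|%N = k * p ^ (valz p a).+1)%N.
  by rewrite {1}(unit_part_valzE a) abszM ek /= expnS mulnA.
move=> e; have : (p ^ (valz p a).+1 %| `|a|)%N by rewrite e dvdn_mull.
by rewrite pfactor_dvdn ?absz_gt0 // ltnn.
Qed.

Lemma valz_coprime a : ~~ (p%:Z %| a)%Z -> valz p a = 0%N.
Proof. by rewrite dvdzE /= => pa; rewrite /valz lognE p_pr (negPf pa) /= andbF. Qed.

Lemma unit_part_coprime a : ~~ (p%:Z %| a)%Z -> unit_part p a = a.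
Proof. by move=> pa; rewrite /unit_part valz_coprime // expn0 divz1. Qed.

Lemma valzM a b : a != 0 -> b != 0 -> valz p (a * b) = (valz p a + valz p b)%N.
Proof. by move=> a0 b0; rewrite /valz abszM lognM // absz_gt0. Qed.

Lemma unit_partM a b : a != 0 -> b != 0 -> unit_part p (a * b) = unit_part p a * unit_part p b.
Proof.
move=> a0 b0; apply: (mulIf (pexpz_neq0 (valz p (a * b)))); rewrite -unit_part_valzE.
by rewrite valzM // expnD PoszM mulrACA -!unit_part_valzE.
Qed.

Lemma valz_prime : valz p p = 1%N.
Proof. by rewrite /valz /= logn_prime // eqxx. Qed.

Lemma unit_part_prime : unit_part p p = 1.
Proof. by rewrite /unit_part valz_prime expn1 divzz; have := prime_gt0 p_pr; case: p. Qed.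

Lemma hilbertC a b : hilbert p a b = hilbert p b a.
Proof. by rewrite /hilbert mulrAC [(valz p a * _)%N]mulnC. Qed.

Lemma hilbert_coprime a b : ~~ (p%:Z %| a)%Z -> ~~ (p%:Z %| b)%Z ->
  hilbert p a b = 1.
Proof. by move=> pa pb; rewrite /hilbert !valz_coprime // !expr0 !mulr1. Qed.

Lemma hilbert_coprimer a b : ~~ (p%:Z %| b)%Z ->
  hilbert p a b = legendre p b ^+ valz p a.
Proof.
by move=> pb; rewrite /hilbert (unit_part_coprime pb) (valz_coprime pb) muln0 !expr0 !mul1r.
Qed.

Hypothesis p_odd : odd p.

Lemma hilbertMl a a' b : a != 0 -> a' != 0 ->
  hilbert p (a * a') b = hilbert p a b * hilbert p a' b.
Proof.
move=> a0 a0'; rewrite /hilbert valzM // unit_partM // legendreM ?unit_part_ndvd //.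
by rewrite mulnDl !exprD exprMn; ring.
Qed.

Lemma hilbertMr a b b' : b != 0 -> b' != 0 ->
  hilbert p a (b * b') = hilbert p a b * hilbert p a b'.
Proof. by move=> b0 b0'; rewrite ![hilbert p a _]hilbertC hilbertMl. Qed.

Lemma legendre_sqr1 a : legendre p a ^+ 2 = 1.
Proof. by rewrite /legendre; case: ifP. Qed.

Lemma hilbert_sqr1 a b : hilbert p a b ^+ 2 = 1.
Proof.
by rewrite /hilbert !exprMn -!exprM ![(_ * 2)%N]mulnC !exprM !legendre_sqr1 !expr1n !mulr1.
Qed.

End LocalSymbol.

Lemma odd_hilbert_prodMl N a a' b : a != 0 -> a' != 0 ->
  odd_hilbert_prod N (a * a') b = odd_hilbert_prod N a b * odd_hilbert_prod N a' b.
Proof.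
move=> a0 a0'; rewrite -big_split; apply: eq_bigr => p /andP[pp po] /=.
exact: hilbertMl.
Qed.

Lemma odd_hilbert_prodMr N a b b' : b != 0 -> b' != 0 ->
  odd_hilbert_prod N a (b * b') = odd_hilbert_prod N a b * odd_hilbert_prod N a b'.
Proof.
move=> a0 a0'; rewrite -big_split; apply: eq_bigr => p /andP[pp po] /=.
exact: hilbertMr.
Qed.

Lemma odd_hilbert_prod_primeN1 N q : prime q -> odd q -> (q < N)%N ->
  odd_hilbert_prod N q (-1) = (-1) ^+ q./2.
Proof.
move=> q_pr q_odd qN.
have nd p : prime p -> ~~ (p%:Z %| -1)%Z.
  by move=> p_pr; rewrite dvdzE /= dvdn1; have := prime_gt1 p_pr; lia.
rewrite /odd_hilbert_prod (bigD1 (Ordinal qN)) /= ?q_pr // big1 => [|p].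
  rewrite mulr1 hilbert_coprimer ?nd // valz_prime // expr1; exact: legendreN1.
move=> /andP[/andP[p_pr p_odd] /eqP pq]; apply: hilbert_coprime; rewrite ?nd //.
by rewrite dvdzE /= dvdn_prime2 //; apply/eqP => e; apply: pq; apply: val_inj.
Qed.

Lemma odd_hilbert_prod_prime N q r : prime q -> odd q -> prime r -> odd r ->
  (q < N)%N -> (r < N)%N -> odd_hilbert_prod N q r = (-1) ^+ (q./2 * r./2).
Proof.
move=> q_pr q_odd r_pr r_odd qN rN.
have nd p p' : prime p -> prime p' -> p != p' -> ~~ (p%:Z %| p'%:Z)%Z.
  by move=> p_pr p_pr' pp'; rewrite dvdzE /= dvdn_prime2.
rewrite /odd_hilbert_prod (bigD1 (Ordinal qN)) /= ?q_pr //.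
have [eqr|qr] := eqVneq q r.
  subst r; rewrite big1 => [|p /andP[/andP[p_pr p_odd] pq]]; last first.
    by apply: hilbert_coprime; rewrite ?nd.
  (* Here (q, q)_q is the Legendre symbol of -1, and (q - 1) / 2 has the parity of its square. *)
  rewrite /hilbert valz_prime // unit_part_prime // /legendre expr1n eqxx !mulr1.
  rewrite -/(legendre q (-1)) legendreN1 //.
  by rewrite -signr_odd -[RHS]signr_odd oddM andbb.
rewrite (bigD1 (Ordinal rN)) /=; last first.
  by rewrite r_pr r_odd /=; apply: contraNneq qr => /(congr1 val) /= ->.
rewrite big1 => [|p /andP[/andP[/andP[p_pr p_odd] pq] pr]]; last first.
  by apply: hilbert_coprime; rewrite ?nd.
rewrite mulr1 hilbert_coprimer ?nd // [hilbert r _ _]hilbertC.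
rewrite hilbert_coprimer ?nd 1?eq_sym // !valz_prime // !expr1.
exact: quadratic_reciprocity.
Qed.

(** On odd integers this is the nontrivial character mod 4. It replaces (-1)^((a - 1) / 2) in the
    reciprocity law and also covers negative a. *)
Definition chi4 (a : int) : int := if (a %% 4)%Z == 1 then 1 else -1.

Lemma chi4M (a b : int) : ~~ (2 %| a)%Z -> ~~ (2 %| b)%Z -> chi4 (a * b) = chi4 a * chi4 b.
Proof.
move=> oa ob; rewrite /chi4.
have [ea|ea] : (a %% 4)%Z = 1 \/ (a %% 4)%Z = 3 by lia.
all: have [eb|eb] : (b %% 4)%Z = 1 \/ (b %% 4)%Z = 3 by lia.
all: by rewrite -modzMm ea eb.
Qed.

Lemma odd_prime_ind (P : nat -> Prop) : P 1%N ->
    (forall q n, prime q -> odd q -> odd n -> P n -> P (q * n)%N) ->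
  forall n, odd n -> P n.
Proof.
move=> P1 PM n; have [m] := ubnP n; elim: m n => // m IH n nm n_odd.
have [n1|n1] := leqP n 1; first by have -> : n = 1%N by lia.
have p_pr := pdiv_prime n1; have /dvdnP[k ek] := pdiv_dvd n.
have := n_odd; rewrite {1}ek oddM => /andP[ok op].
rewrite ek mulnC; apply: PM => //; apply: IH => //.
have := prime_gt1 p_pr; rewrite {1}ek in nm; move: nm; set x := pdiv n; nia.
Qed.

(** Both sides are multiplicative in d, so reciprocity for the odd prime factors of d and the value
    at -1 suffice. *)
Lemma odd_hilbert_prod_primel N q (d : int) : prime q -> odd q -> (q < N)%N ->
  ~~ (2 %| d)%Z -> (`|d| < N)%N -> odd_hilbert_prod N q d = chi4 d ^+ q./2.
Proof.
move=> q_pr q_odd qN.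
have q0 : q%:Z != 0 by rewrite eqz_nat -lt0n prime_gt0.
have pos n : odd n -> (n < N)%N -> odd_hilbert_prod N q n = chi4 n ^+ q./2.
  move: n; apply: odd_prime_ind => [_|r n r_pr r_odd n_odd IH rn].
    rewrite expr1n /odd_hilbert_prod; apply: big1 => p /andP[p_pr p_odd].
    rewrite hilbert_coprimer // ?dvdzE /= ?dvdn1.
      by rewrite /legendre expr1n eqxx expr1n.
    by have := prime_gt1 p_pr; lia.
  have r0 := prime_gt0 r_pr; have n0 : (0 < n)%N by rewrite odd_gt0.
  have rN : (r < N)%N by apply: leq_ltn_trans rn; rewrite leq_pmulr.
  have nN : (n < N)%N by apply: leq_ltn_trans rn; rewrite leq_pmull.
  rewrite PoszM odd_hilbert_prodMr; try by rewrite eqz_nat -lt0n.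
  rewrite IH // odd_hilbert_prod_prime // chi4M; try lia.
  rewrite exprMn; congr (_ * _); rewrite mulnC exprM; congr (_ ^+ _).
  rewrite /chi4 -signr_odd.
  case e: (odd r./2); case: eqP => //; lia.
move=> d_odd dN; case: (intP d) d_odd dN => [|n|n] // d_odd dN.
  by apply: pos; lia.
rewrite -mulN1r odd_hilbert_prodMr //.
rewrite odd_hilbert_prod_primeN1 // pos; try lia.
by rewrite chi4M; try lia; rewrite exprMn.
Qed.

Lemma odd_hilbert_prod_eq1 N (g : nat) (d : int) : odd g -> (g < N)%N ->
  (d %% 4)%Z = 1 -> (`|d| < N)%N -> odd_hilbert_prod N g d = 1.
Proof.
move=> + + d4 dN; move: g; apply: odd_prime_ind => [_|q n q_pr q_odd n_odd IH qn].
  rewrite /odd_hilbert_prod; apply: big1 => p /andP[p_pr p_odd].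
  rewrite hilbertC hilbert_coprimer // ?dvdzE /= ?dvdn1.
    by rewrite /legendre expr1n eqxx expr1n.
  by have := prime_gt1 p_pr; lia.
have q0 := prime_gt0 q_pr; have n0 : (0 < n)%N by rewrite odd_gt0.
have qN : (q < N)%N by apply: leq_ltn_trans qn; rewrite leq_pmulr.
have nN : (n < N)%N by apply: leq_ltn_trans qn; rewrite leq_pmull.
rewrite PoszM odd_hilbert_prodMl; try by rewrite eqz_nat -lt0n.
rewrite IH // odd_hilbert_prod_primel //; last by lia.
by rewrite /chi4 d4 expr1n.
Qed.

(* The factor at 2 is trivial since v_2(g) is even and d = 1 mod 4. *)
Lemma hilbert_product (g d : int) : 0 < g -> ~~ (2 %| g)%Z \/ ((4 %| g)%Z /\ ~~ (8 %| g)%Z) ->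
  (d %% 4)%Z = 1 ->
  exists N, [/\ (`|g| < N)%N, (`|d| < N)%N & odd_hilbert_prod N g d = 1].
Proof.
move=> g0 gv d4; pose N := (`|g| + `|d|).+1%N; exists N; split; try lia.
case: gv => [g2|[g4 g8]].
  by rewrite -(gez0_abs (ltW g0)) odd_hilbert_prod_eq1 //; lia.
have [k ek] : exists k : nat, g = 2 * (2 * k%:Z).
  by exists (`|g| %/ 4)%N; lia.
have ok : odd k by lia.
have k0 : k%:Z != 0 by case: k {ek} ok.
rewrite ek !odd_hilbert_prodMl ?mulf_neq0 // mulrA odd_hilbert_prod_eq1 //; try lia.
rewrite mulr1 -expr2 -prodrXl; apply: big1 => p /andP[p_pr p_odd].
exact: hilbert_sqr1.
Qed.

(** * Forms that are a multiple of a square on a plane *)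

(** [J] exchanges the column blocks up to sign and is a product of block shears, hence has
    determinant 1; multiplying by it gives a block triangular matrix. *)
Lemma det_block0 (R : comPzRingType) n (B C D : 'M[R]_n) :
  \det (block_mx 0 B C D) = (-1) ^+ n * \det B * \det C.
Proof.
pose J : 'M[R]_(n + n) := block_mx 0 1%:M (- 1%:M) 0.
have detJ : \det J = 1.
  have -> : J = block_mx 1%:M 1%:M 0 1%:M *m block_mx 1%:M 0 (- 1%:M) 1%:M
              *m block_mx 1%:M 1%:M 0 1%:M.
    rewrite !mulmx_block !(mulmx0, mul0mx, mulmx1, mul1mx, mulmxN, mulNmx).
    by rewrite !(addr0, add0r, subrr, addNr, subr0, opprK).
  by rewrite !det_mulmx !det_ublock det_lblock !det1 !mulr1.
rewrite -[LHS]mulr1 -[X in _ * X = _]detJ -det_mulmx mulmx_block.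
rewrite !(mulmx0, mul0mx, mulmx1, mul1mx, mulmxN, mulNmx, addr0, add0r).
by rewrite det_lblock -[- B]scaleN1r detZ.
Qed.

Lemma rat_mx_common_denom m n (A : 'M[rat]_(m, n)) :
  exists k : int, exists2 M : 'M[int]_(m, n),
    k != 0 & k%:~R *: A = map_mx intr M.
Proof.
pose k := \prod_i \prod_j denq (A i j); exists k.
exists (\matrix_(i, j) numq (k%:~R * A i j)).
  by apply/prodf_neq0 => i _; apply/prodf_neq0 => j _; rewrite denq_eq0.
apply/matrixP => i j; rewrite !mxE numqK // /k (bigD1 i) //= (bigD1 j) //=.
rewrite !rmorphM /=; set r1 := \prod_(_ < _ | _) _; set r2 := \prod_(_ < _ | _) _.
rewrite (_ : (_ * A i j)%R = (numq (A i j))%:~R * (r1%:~R * r2%:~R) :> rat).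
  by rewrite !rpredM ?intr_int.
by rewrite numqE; ring.
Qed.

Section IsotropicPlane.
Variable p : nat.
Hypothesis p_pr : prime p.

(** Unless z = 0, the valuation of k z^2 is odd, so G cannot be prime to p. *)
Lemma odd_val_square_dvd (k G : int) (z : rat) : k != 0 -> odd (valz p k) ->
  G%:~R = k%:~R * z ^+ 2 -> (p%:Z %| G)%Z.
Proof.
move=> k0 ko; rewrite -[z]divq_num_den expr_div_n => e.
have d0 : denq z != 0 by rewrite denq_eq0.
have {e} e : G * denq z ^+ 2 = k * numq z ^+ 2.
  apply: (@intr_inj rat); rewrite !rmorphM /= e; field.
  by rewrite intr_eq0.
have [n0|n0] := eqVneq (numq z) 0.
  move/eqP: e; rewrite n0 expr0n mulr0 mulf_eq0 expf_eq0 (negPf d0) andbF orbF.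
  by move/eqP ->; rewrite dvdz0.
have G0 : G != 0.
  apply/eqP => G0; move/esym/eqP: e; rewrite G0 mul0r mulf_eq0 expf_eq0.
  by rewrite (negPf k0) (negPf n0).
apply: contraT => /(valz_coprime p_pr) v0.
have := congr1 (valz p) e; rewrite !expr2 !(valzM p) ?mulf_neq0 // v0.
by lia.
Qed.

(* A form that is k times a square on a rational plane, with v_p(k) odd, vanishes
   mod p on the saturated integral lattice of that plane, so its Gram matrix mod p has
   a zero 2 x 2 block. *)
Lemma plane_det_square (E : 'M[int]_(2 + 2)) (A : 'M[rat]_(2, 2 + 2))
    (y : 'cV[rat]_2) (k : int) :
    E^T = E -> k != 0 -> odd (valz p k) -> \rank A = 2%N ->
    A *m map_mx intr E *m A^T = k%:~R *: (y *m y^T) ->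
  exists c : 'F_p, (\det E)%:~R = c ^+ 2.
Proof.
move=> Esym k0 ko rA AE.
have [n [M n0 eM]] := rat_mx_common_denom A.
(* The first two rows of the unimodular [R] are a basis of the saturated lattice of the plane, and
   [R] itself completes it to a basis of the whole lattice, still a basis mod p. *)
have [L uL [R uR [ds _ eS]]] := int_Smith_normal_form M.
pose U := L *m diag_mx (\row_(i < 2) ds`_i).
have eU : M = U *m usubmx R.
  rewrite eS -{1}[R]vsubmxK /U -!mulmxA; congr (_ *m _).
  rewrite -[X in X *m _ = _]hsubmxK mul_row_col [X in _ + X *m _](_ : _ = 0).
    rewrite mul0mx addr0; congr (_ *m _); apply/matrixP => i j; rewrite !mxE /=.
    by rewrite -val_eqE.
  apply/matrixP => i j; rewrite !mxE /= (_ : (_ == _) = false) ?mulr0n //.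
  by have := ltn_ord i; lia.
pose Uq : 'M[rat]_2 := map_mx intr U.
have nq0 : n%:~R != 0 :> rat by rewrite intr_eq0.
have uU : Uq \in unitmx.
  rewrite -row_free_unit -row_leq_rank -{1}rA -(eqmx_scale A nq0) eM eU map_mxM.
  exact: mxrankM_maxl.
have eR : map_mx intr (usubmx R) = n%:~R *: invmx Uq *m A.
  by rewrite -scalemxAl scalemxAr eM eU map_mxM mulKmx.
pose z := n%:~R *: invmx Uq *m y.
pose G := usubmx R *m E *m (usubmx R)^T.
have eG i j : (G i j)%:~R = k%:~R * (z i 0 * z j 0).
  have : map_mx intr G = k%:~R *: (z *m z^T).
    rewrite !map_mxM -map_trmx eR trmx_mul -!mulmxA.
    rewrite [A *m (_ *m _)]mulmxA [A *m _ *m (_ *m _)]mulmxA AE.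
    by rewrite /z trmx_mul -!scalemxAl -!scalemxAr !mulmxA scalerA mulrC -scalerA.
  by move/matrixP/(_ i j); rewrite !mxE big_ord1 !mxE.
have pGii i : (p%:Z %| G i i)%Z.
  by apply: (@odd_val_square_dvd k _ (z i 0)) => //; rewrite eG expr2.
(* The Gram matrix is k z z^T, of rank at most one: the square of an entry is a product of two
   diagonal ones. *)
have pG i j : (p%:Z %| G i j)%Z.
  have : (p%:Z %| G i j ^+ 2)%Z.
    rewrite (_ : _ ^+ 2 = G i i * G j j) ?dvdz_mulr //.
    by apply: (@intr_inj rat); rewrite rmorphXn rmorphM /= !eG; ring.
  by rewrite !dvdzE abszX Euclid_dvdX // andbT.
pose Rp : 'M['F_p]_(2 + 2) := map_mx intr R.
pose Ep : 'M['F_p]_(2 + 2) := map_mx intr E.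
have detRp : \det Rp ^+ 2 = 1.
  rewrite det_map_mx -rmorphXn /=; have : \det R \is a GRing.unit by [].
  by rewrite qualifE => /orP[]/eqP->.
pose H := Rp *m Ep *m Rp^T.
have Hsym : H^T = H.
  by rewrite /H !trmx_mul trmxK mulmxA map_trmx Esym.
have H0 : ulsubmx H = 0.
  rewrite (_ : ulsubmx H = map_mx intr G).
    by apply/matrixP => i j; rewrite [LHS]mxE [RHS]mxE; apply/eqP; rewrite Fp_intr_eq0.
  rewrite /ulsubmx /H !map_mxM -map_trmx map_usubmx -/Rp -/Ep.
  rewrite -[in LHS](vsubmxK Rp) !mul_col_mx col_mxKu tr_col_mx mul_mx_row.
  by rewrite row_mxKl.
have : \det H = \det (ursubmx H) ^+ 2.
  rewrite -{1}(submxK H) H0 det_block0 sqrrN expr1n mul1r.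
  by rewrite -(trmxK (dlsubmx H)) trmx_dlsub Hsym det_tr.
rewrite /H !det_mulmx det_tr mulrAC -expr2 detRp mul1r => e.
by exists (\det (ursubmx H)); rewrite -e det_map_mx.
Qed.
End IsotropicPlane.

(** * Square roots of zeta *)

Definition zeta_poly : {poly rat} := 'X^3 + 3%:R * 'X^2 + 3%:R * 'X - 9%:R.

(** As [zeta_poly] is (T + 1)^3 - 10, this excludes a rational root. The 2-adic valuation of 10 is
    1, which is not a multiple of 3. *)
Lemma rat_cube_neq10 (r : rat) : r ^+ 3 != 10%:R.
Proof.
apply/eqP => e; have d0 : denq r != 0 by rewrite denq_eq0.
have r0 : numq r != 0.
  by rewrite numq_eq0; apply/eqP => r0; move: e; rewrite r0 expr0n /= => /eqP.
have {e} e : numq r * (numq r * numq r) = 2 * (5 * (denq r * (denq r * denq r))).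
  apply: (@intr_inj rat); rewrite !rmorphM /= !numqE.
  have -> : 2%:~R * (5%:~R * ((denq r)%:~R * ((denq r)%:~R * (denq r)%:~R))) =
    10%:R * (denq r)%:~R ^+ 3 :> rat by ring.
  by rewrite -e; ring.
have := congr1 (valz 2) e; rewrite !valzM ?mulf_neq0 //.
have -> : valz 2 2 = 1%N by [].
have -> : valz 2 5 = 0%N by [].
lia.
Qed.

Lemma zeta_poly_size : size zeta_poly = 4%N.
Proof.
rewrite /zeta_poly -!addrA size_polyDl ?size_polyXn //.
apply: leq_ltn_trans (size_polyD _ _) _; rewrite gtn_max.
rewrite -!polyC_natr !mul_polyC (leq_ltn_trans (size_scale_leq _ _)) ?size_polyXn //=.
apply: leq_ltn_trans (size_polyD _ _) _; rewrite gtn_max size_polyN.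
rewrite (leq_ltn_trans (size_scale_leq _ _)) ?size_polyX //=.
by rewrite (leq_ltn_trans (size_polyC_leq1 _)).
Qed.

Lemma zeta_poly_irreducible : irreducible_poly zeta_poly.
Proof.
apply: cubic_irreducible; rewrite ?zeta_poly_size // => r.
apply: contra (rat_cube_neq10 (r + 1)); rewrite /root /zeta_poly -!polyC_natr.
rewrite !hornerE /= => /eqP e.
by rewrite -subr_eq0; apply/eqP; rewrite -[RHS]e; ring.
Qed.

Section SqrtZeta.
Variables (L : fieldExtType rat) (zeta : L).
Hypothesis zeta_root : root ('X^3 + 3%:R * 'X^2 + 3%:R * 'X - 9%:R) zeta.
Hypothesis zeta_gen : <<1; zeta>>%VS = {:L}%VS.

Definition zeta_quad (c : rat * rat * rat) : L :=
  c.1.1 *: 1 + c.1.2 *: zeta + c.2 *: zeta ^+ 2.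

Lemma zeta_cube : zeta ^+ 3 = 9%:R - 3%:R * zeta - 3%:R * zeta ^+ 2.
Proof.
move/rootP: zeta_root; rewrite -!polyC_natr !hornerE /= => e.
by rewrite -[RHS]addr0 -[X in _ + X]e; ring.
Qed.

Lemma map_zeta_poly_root : (map_poly (in_alg L) zeta_poly).[zeta] = 0.
Proof.
rewrite /zeta_poly rmorphB !rmorphD /= map_polyXn !rmorphM /= ?map_polyX !rmorph_nat.
by rewrite -!polyC_natr !hornerE /= zeta_cube !rmorph1 !hornerC; ring.
Qed.

Lemma zeta_powers_span (x : L) : exists c, x = zeta_quad c.
Proof.
have : x \in <<1; zeta>>%VS by rewrite zeta_gen memvf.
case/Fadjoin1_polyP => q ->.
exists ((q %% zeta_poly)`_0, (q %% zeta_poly)`_1, (q %% zeta_poly)`_2).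
rewrite [in LHS](divp_eq q zeta_poly) rmorphD rmorphM /= hornerD hornerM.
rewrite map_zeta_poly_root mulr0 add0r.
rewrite (@horner_coef_wide _ 3); last first.
  rewrite size_map_poly -ltnS -zeta_poly_size ltn_modp.
  by rewrite -size_poly_eq0 zeta_poly_size.
rewrite !big_ord_recl big_ord0 addr0 !coef_map /= /bump /= addrA.
by rewrite /zeta_quad !mulr_algl expr0 expr1.
Qed.

Lemma zeta_powers_free c : zeta_quad c = 0 -> c = (0, 0, 0).
Proof.
case: c => [[a b] c]; rewrite /zeta_quad /= => e.
pose q : {poly rat} := a%:P + b *: 'X + c *: 'X^2.
have [q0|q0] := eqVneq q 0.
  have h i : q`_i = 0 by rewrite q0 coef0.
  have := h 0%N; have := h 1%N; have := h 2%N.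
  rewrite /q !coefD !coefZ !coefC !coefX !coefXn /=.
  by rewrite !(mulr0, mulr1, add0r, addr0) => -> -> ->.
have sq : (size q < size zeta_poly)%N.
  rewrite zeta_poly_size ltnS.
  apply: leq_trans (size_polyD _ _) _; rewrite geq_max.
  rewrite (leq_trans (size_scale_leq _ _)) ?size_polyXn // andbT.
  apply: leq_trans (size_polyD _ _) _; rewrite geq_max.
  rewrite (leq_trans (size_scale_leq _ _)) ?size_polyX // andbT.
  by rewrite (leq_trans (size_polyC_leq1 _)).
have qz : (map_poly (in_alg L) q).[zeta] = 0.
  rewrite /q !rmorphD /= !map_polyZ /= map_polyC map_polyX map_polyXn /=.
  by rewrite !hornerE /= -mulrA -expr2 !mulr_algl.
have /Bezout_eq1_coprimepP[[u v] /= uv] : coprimep zeta_poly q.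
  have [_ irr] := zeta_poly_irreducible.
  rewrite /coprimep; apply/negPn/negP => /irr /(_ (dvdp_gcdl _ _)).
  move/eqp_size => sg; have := dvdp_leq q0 (dvdp_gcdr zeta_poly q).
  by rewrite sg leqNgt sq.
have := congr1 (fun r => (map_poly (in_alg L) r).[zeta]) uv.
rewrite rmorphD !rmorphM rmorph1 /= hornerD !hornerM hornerC.
rewrite map_zeta_poly_root qz !mulr0 addr0 => /eqP.
by rewrite eq_sym oner_eq0.
Qed.

Lemma zeta_quadD c c' :
  zeta_quad (c.1.1 + c'.1.1, c.1.2 + c'.1.2, c.2 + c'.2) = zeta_quad c + zeta_quad c'.
Proof. by rewrite /zeta_quad /= !scalerDl; ring. Qed.

Lemma zeta_quadZ (k : rat) c : zeta_quad (k * c.1.1, k * c.1.2, k * c.2) = k *: zeta_quad c.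
Proof. by rewrite /zeta_quad /= -!scalerA !scalerDr. Qed.

Lemma zeta_quad_inj : injective zeta_quad.
Proof.
move=> [[a b] c] [[a' b'] c'] e.
have : zeta_quad (a - a', b - b', c - c') = 0.
  move/eqP: e; rewrite -subr_eq0 => /eqP <-.
  by rewrite /zeta_quad /= !scalerBl; ring.
by move/zeta_powers_free => -[/subr0_eq -> /subr0_eq -> /subr0_eq ->].
Qed.

(* The three equations are the coordinates of (a + b zeta + c zeta^2)^2 = zeta. *)
Lemma tensor_sqrt_zeta (K : fieldType) (iota : {rmorphism rat -> K})
    (y : tensor iota L) : y ^+ 2 = tens iota 1 zeta ->
  exists a b c : K, [/\ a ^+ 2 + 18%:R * b * c - 27%:R * c ^+ 2 = 0,
    2%:R * a * b - 6%:R * b * c + 18%:R * c ^+ 2 = 1 &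
    b ^+ 2 + 2%:R * a * c - 6%:R * b * c + 6%:R * c ^+ 2 = 0].
Proof.
move=> ey.
have [co coE] := choice zeta_powers_span.
have co_quad c : co (zeta_quad c) = c by apply: zeta_quad_inj; rewrite -coE.
have coD x x' : co (x + x') =
    ((co x).1.1 + (co x').1.1, (co x).1.2 + (co x').1.2, (co x).2 + (co x').2).
  by apply: zeta_quad_inj; rewrite -coE zeta_quadD -!coE.
have coZ k x : co (k *: x) = (k * (co x).1.1, k * (co x).1.2, k * (co x).2).
  by apply: zeta_quad_inj; rewrite -coE zeta_quadZ -!coE.
have co0 : co 0 = (0, 0, 0) by have := coZ 0 0; rewrite scale0r !mul0r.
pose e := vbasis {:L}.
(* Tensors are stored on the basis [vbasis {:L}], not on the powers of zeta; each power-basis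
   coordinate of L is extended to a K-linear map on the tensor product. *)
have lift (pr : rat * rat * rat -> rat) :
    {morph (fun x => pr (co x)) : x x' / x + x'} -> pr (co 0) = 0 ->
    (forall k x, pr (co (k *: x)) = k * pr (co x)) ->
    exists Phi : tensor iota L -> K, {morph Phi : u v / u + v}
      /\ (forall k x, Phi (tens iota k x) = k * iota (pr (co x))).
  move=> prD pr0 prZ.
  exists (fun v : tensor iota L => \sum_(i < \dim {:L}) v 0 i * iota (pr (co e`_i))).
  split.
    by move=> u v; rewrite -big_split; apply: eq_bigr => i _; rewrite mxE mulrDl.
  move=> k x; rewrite [in RHS](coord_vbasis (memvf x)).
  rewrite (big_morph (fun x => pr (co x)) prD pr0) rmorph_sum mulr_sumr.
  by apply: eq_bigr => i _; rewrite mxE prZ rmorphM mulrA.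
have [P0 [P0D P0t]] : exists Phi : tensor iota L -> K, {morph Phi : u v / u + v}
      /\ (forall k x, Phi (tens iota k x) = k * iota (co x).1.1).
  by apply: (lift (fun c => c.1.1)) => [x x'||k x]; rewrite ?coD ?co0 ?coZ.
have [P1 [P1D P1t]] : exists Phi : tensor iota L -> K, {morph Phi : u v / u + v}
      /\ (forall k x, Phi (tens iota k x) = k * iota (co x).1.2).
  by apply: (lift (fun c => c.1.2)) => [x x'||k x]; rewrite ?coD ?co0 ?coZ.
have [P2 [P2D P2t]] : exists Phi : tensor iota L -> K, {morph Phi : u v / u + v}
      /\ (forall k x, Phi (tens iota k x) = k * iota (co x).2).
  by apply: (lift (fun c => c.2)) => [x x'||k x]; rewrite ?coD ?co0 ?coZ.
have dec (u : tensor iota L) :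
    u = tens iota (P0 u) 1 + tens iota (P1 u) zeta + tens iota (P2 u) (zeta ^+ 2).
  elim/tensor_ind: u => [|u v IHu IHv|k x].
  - have z P : {morph P : u v / u + v} -> P (0 : tensor iota L) = 0 :> K.
      by move=> PD; apply: (@addrI _ (P 0)); rewrite -PD !addr0.
    by rewrite (z P0) ?(z P1) ?(z P2) // !tens0l !addr0.
  - rewrite {1}IHu {1}IHv P0D P1D P2D !tensDl.
    by rewrite !addrA -!(addrAC _ _ (tens iota (P0 v) 1)) -!addrA;
       congr (_ + (_ + _)); rewrite addrCA.
  rewrite {1}[x]coE /zeta_quad !tensDr !tensZ P0t P1t P2t; by [].
pose a := P0 y; pose b := P1 y; pose c := P2 y.
have yy : tensor_mul y y = tens iota 1 zeta by [].
exists a, b, c.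
have c1 : co 1 = (1, 0, 0).
  by rewrite -[RHS]co_quad /zeta_quad /= scale1r !scale0r !addr0.
have cz1 : co zeta = (0, 1, 0).
  by rewrite -[RHS]co_quad /zeta_quad /= scale1r !scale0r addr0 add0r.
have cz2 : co (zeta * zeta) = (0, 0, 1).
  by rewrite -[RHS]co_quad /zeta_quad /= scale1r !scale0r !add0r.
have nZ (n : nat) (x : L) : n%:R * x = n%:R *: x by rewrite scaler_nat mulr_natl.
have cz3 : co (zeta * zeta ^+ 2) = (9%:R, -3%:R, -3%:R).
  rewrite -[RHS]co_quad /zeta_quad /= -exprS zeta_cube !nZ !scaleNr.
  by rewrite -{1}[9%:R]mulr1 nZ.
have cz4 : co (zeta ^+ 2 * zeta ^+ 2) = (-27%:R, 18%:R, 6%:R).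
  rewrite -[RHS]co_quad; congr co; rewrite /zeta_quad /= !scaleNr -!nZ.
  transitivity (zeta * zeta ^+ 3); first by ring.
  rewrite zeta_cube; transitivity (9%:R * zeta - 3%:R * zeta ^+ 2 - 3%:R * zeta ^+ 3).
    by ring.
  by rewrite zeta_cube; ring.
have key P (pr : rat * rat * rat -> rat) : {morph P : u v / u + v} ->
    (forall k x, P (tens iota k x) = k * iota (pr (co x))) ->
    a ^+ 2 * iota (pr (co 1)) + (2%:R * a * b) * iota (pr (co zeta))
    + (b ^+ 2 + 2%:R * a * c) * iota (pr (co (zeta * zeta)))
    + (2%:R * b * c) * iota (pr (co (zeta * zeta ^+ 2)))
    + c ^+ 2 * iota (pr (co (zeta ^+ 2 * zeta ^+ 2))) = iota (pr (co zeta)).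
  move=> PD Pt; have := congr1 P yy; rewrite Pt mul1r => hz.
  rewrite -[RHS]hz (dec y) -/a -/b -/c.
  rewrite !(tensor_mulDl, tensor_mulDr) !tens_mul !PD !Pt.
  rewrite !mul1r !mulr1 [zeta ^+ 2 * zeta]mulrC -!expr2; ring.
split.
- have := key P0 (fun c => c.1.1) P0D P0t; rewrite c1 cz1 cz2 cz3 cz4 /=.
  rewrite !rmorphN !rmorph_nat !rmorph0 !rmorph1 => h; rewrite -[RHS]h; ring.
- have := key P1 (fun c => c.1.2) P1D P1t; rewrite c1 cz1 cz2 cz3 cz4 /=.
  rewrite !rmorphN !rmorph_nat !rmorph0 !rmorph1 => h; rewrite -[RHS]h; ring.
have := key P2 (fun c => c.2) P2D P2t; rewrite c1 cz1 cz2 cz3 cz4 /=.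
rewrite !rmorphN !rmorph_nat !rmorph0 !rmorph1 => h; rewrite -[RHS]h; ring.
Qed.
End SqrtZeta.

(** * Conics over the p-adic numbers *)

Lemma fraction_numden (R : idomainType) (x : {fraction R}) :
  exists a b : R, b != 0 /\ x * tofrac b = tofrac a.
Proof.
elim/quotW: x => r; exists \n_r, \d_r; split; first exact: denom_ratioP.
unlock tofrac; rewrite -[LHS]FracField.pi_mul; apply/eqmodP.
rewrite /= FracField.equivfE /FracField.mulf !numden_Ratio ?oner_neq0 //.
by rewrite !mulr1 mulrC.
all: by rewrite ?mulr1 ?denom_ratioP ?oner_neq0.
Qed.

Lemma Zp_intr_eq0 m (a : int) : (1 < m)%N -> a%:~R = 0 :> 'Z_m -> (m%:Z %| a)%Z.
Proof.
move=> m1; have nat_case k : k%:R = 0 :> 'Z_m -> (m %| k)%N.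
  by move/(congr1 val); rewrite /= val_Zp_nat // => /eqP.
case: a => n; first by rewrite dvdzE; exact: nat_case.
by rewrite NegzE mulrNz dvdzE /= => /eqP; rewrite oppr_eq0 => /eqP /nat_case.
Qed.

Section PadicResidue.
Variables (p : prime_nat) (n : nat).

(** The exponent n + 1 keeps the modulus m above 1, where ['Z_m] really is Z / m. *)
Definition padic_mod (x : padic_int p) : 'Z_(p ^ n.+1) := (residue x n.+1)%:R.

Fact padic_mod_gt1 : (1 < p ^ n.+1)%N.
Proof. by rewrite (ltn_exp2l 0) // prime_gt1 // prime_valP. Qed.

Fact padic_mod_nmod : nmod_morphism padic_mod.
Proof.
split=> [|x y]; rewrite /padic_mod /=; first by rewrite mod0n.
by rewrite Zp_nat_mod ?padic_mod_gt1 // natrD.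
Qed.

Fact padic_mod_monoid : monoid_morphism padic_mod.
Proof.
split=> [|x y]; rewrite /padic_mod /= Zp_nat_mod ?padic_mod_gt1 //.
by rewrite natrM.
Qed.

HB.instance Definition _ := GRing.isNmodMorphism.Build _ _ padic_mod padic_mod_nmod.
HB.instance Definition _ := GRing.isMonoidMorphism.Build _ _ padic_mod padic_mod_monoid.
End PadicResidue.

Lemma padic_residue_neq0 (p : prime_nat) (x : padic_int p) : x != 0 ->
  exists N, forall n, (N <= n)%N -> ~~ ((p ^ N)%:Z %| (residue x n)%:Z)%Z.
Proof.
move=> /eqP x0; have [N xN] : exists N, residue x N <> 0%N.
  apply/not_existsP => h; apply: x0; apply: residue_inj => n /=.
  by rewrite mod0n; apply: contrapT; exact: h.
exists N => n Nn; rewrite dvdzE /= /dvdn (residue_mod x Nn); exact/eqP.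
Qed.

(** Descent on M: as long as p divides x, y and z, dividing them by p lowers M by 1 and the exponent
    by 2. The initial exponent 2 M + 2 leaves p^2 at the end. *)
Lemma primitive_zero_mod_sq (p : nat) (G D x y z : int) M : prime p ->
    ~~ [&& (p ^ M)%:Z %| x, (p ^ M)%:Z %| y & (p ^ M)%:Z %| z]%Z ->
    ((p ^ (M * 2 + 2))%:Z %| x ^+ 2 - G * y ^+ 2 - D * z ^+ 2)%Z ->
  exists x y z : int, ~~ [&& p%:Z %| x, p%:Z %| y & p%:Z %| z]%Z /\
    ((p ^ 2)%:Z %| x ^+ 2 - G * y ^+ 2 - D * z ^+ 2)%Z.
Proof.
move=> p_pr; have p0 : p%:Z != 0 by rewrite eqz_nat -lt0n prime_gt0.
elim: M x y z => [|M IH] x y z; first by rewrite expn0 !dvd1z.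
move=> prim h.
have [/and3P[/dvdzP[x' ex] /dvdzP[y' ey] /dvdzP[z' ez]]|] :=
  boolP [&& p%:Z %| x, p%:Z %| y & p%:Z %| z]%Z; last first.
  move=> np; exists x, y, z; split=> //; apply: dvdz_trans h.
  by rewrite dvdzE /= dvdn_exp2l //; lia.
apply: (IH x' y' z').
  apply: contra prim => /and3P[hx hy hz].
  by rewrite ex ey ez !expnSr !PoszM !dvdz_mul.
have : ((p ^ (M * 2 + 2))%:Z * (p ^ 2)%:Z %|
    (x' ^+ 2 - G * y' ^+ 2 - D * z' ^+ 2) * (p ^ 2)%:Z)%Z.
  have -> : (p ^ (M * 2 + 2))%:Z * (p ^ 2)%:Z = (p ^ (M.+1 * 2 + 2))%:Z.
    by rewrite -PoszM -expnD; congr (Posz (_ ^ _)); lia.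
  rewrite (_ : _ * (p ^ 2)%:Z = x ^+ 2 - G * y ^+ 2 - D * z ^+ 2) //.
  by rewrite ex ey ez -mulnn PoszM; ring.
by rewrite dvdz_mul2r // -mulnn PoszM mulf_neq0.
Qed.

(** After clearing denominators some coordinate is nonzero modulo p^M; the zero is then truncated
    modulo p^(2 M + 2) and made primitive in the integers, so that nothing is divided in Z_p. *)
Lemma padic_conic_primitive (p : prime_nat) (G D : int) (x y z : padic p) :
    (x, y, z) != (0, 0, 0) ->
    x ^+ 2 - G%:~R * y ^+ 2 - D%:~R * z ^+ 2 = 0 ->
  exists x y z : int, ~~ [&& p%:Z %| x, p%:Z %| y & p%:Z %| z]%Z /\
    ((p ^ 2)%:Z %| x ^+ 2 - G * y ^+ 2 - D * z ^+ 2)%Z.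
Proof.
move=> xyz0 h; have p_pr := prime_valP p.
have [a [a' [a0 ea]]] := fraction_numden x.
have [b [b' [b0 eb]]] := fraction_numden y.
have [c [c' [c0 ec]]] := fraction_numden z.
pose X := a * b' * c'; pose Y := a' * b * c'; pose Z := a' * b' * c.
pose k := a' * b' * c'.
have k0 : tofrac k != 0 by rewrite tofrac_eq0 !mulf_neq0.
have eX : tofrac X = x * tofrac k by rewrite !rmorphM /= -ea; ring.
have eY : tofrac Y = y * tofrac k by rewrite !rmorphM /= -eb; ring.
have eZ : tofrac Z = z * tofrac k by rewrite !rmorphM /= -ec; ring.
clearbody X Y Z.
have XYZ : X ^+ 2 - G%:~R * Y ^+ 2 - D%:~R * Z ^+ 2 = 0.
  apply/eqP; rewrite -tofrac_eq0 !rmorphB !rmorphM /= !rmorph_int.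
  rewrite eX eY eZ; apply/eqP.
  transitivity ((x ^+ 2 - G%:~R * y ^+ 2 - D%:~R * z ^+ 2) * tofrac k ^+ 2).
    by ring.
  by rewrite h mul0r.
have nz : [|| X != 0, Y != 0 | Z != 0].
  apply: contraNT xyz0; rewrite !negb_or !negbK => /and3P[X0 Y0 Z0].
  have cancel w W : tofrac W = w * tofrac k -> W == 0 -> w = 0.
    rewrite -tofrac_eq0 => -> W0; apply/eqP; move: W0.
    by rewrite mulf_eq0 (negPf k0) orbF.
  by rewrite (cancel _ _ eX X0) (cancel _ _ eY Y0) (cancel _ _ eZ Z0).
have [M HM] : exists M, forall n, (M <= n)%N ->
    ~~ [&& (p ^ M)%:Z %| (residue X n)%:Z, (p ^ M)%:Z %| (residue Y n)%:Z
         & (p ^ M)%:Z %| (residue Z n)%:Z]%Z.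
  case/or3P: nz => /padic_residue_neq0[M HM]; exists M => n /HM; apply: contra; by case/and3P.
apply: (@primitive_zero_mod_sq p G D (residue X (M * 2 + 2)) (residue Y (M * 2 + 2))
  (residue Z (M * 2 + 2)) M) => //; first by apply: HM; lia.
have -> : (M * 2 + 2 = (M * 2 + 1).+1)%N by lia.
apply: Zp_intr_eq0; first exact: padic_mod_gt1.
have := congr1 (@padic_mod p (M * 2 + 1)) XYZ.
rewrite (rmorph0 (@padic_mod p (M * 2 + 1))) => hh; rewrite -[RHS]hh.
by rewrite !rmorphB !rmorphM /= !rmorph_int.
Qed.

(* unit_part p g * p ^ odd (valz p g) is g up to the square of a power of p. *)
Lemma hilbert_eq1 (p : nat) (g d x y z : int) : prime p -> odd p ->
    g != 0 -> d != 0 ->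
    ~~ [&& p%:Z %| x, p%:Z %| y & p%:Z %| z]%Z ->
    ((p ^ 2)%:Z %| x ^+ 2 - unit_part p g * (p ^ odd (valz p g))%:Z * y ^+ 2
                   - unit_part p d * (p ^ odd (valz p d))%:Z * z ^+ 2)%Z ->
  hilbert p g d = 1.
Proof.
move=> p_pr p_odd g0 d0; rewrite /hilbert.
have sgn_odd a n : legendre p a ^+ n = legendre p a ^+ odd n.
  rewrite -{1}(odd_double_half n) exprD -mul2n exprM legendre_sqr1 // expr1n mulr1 //.
rewrite (sgn_odd _ (valz p g * valz p d)%N) (sgn_odd _ (valz p d)).
rewrite (sgn_odd _ (valz p g)) oddM.
have := unit_part_ndvd p_pr g0; have := unit_part_ndvd p_pr d0.
move: (unit_part p g) (unit_part p d) => u v pv pu.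
have pX (w : int) : (p%:Z %| w ^+ 2)%Z -> (p%:Z %| w)%Z.
  by rewrite !dvdzE abszX Euclid_dvdX // andbT.
have pM (w w' : int) : (p%:Z %| w * w')%Z = (p%:Z %| w)%Z || (p%:Z %| w')%Z.
  by rewrite !dvdzE abszM Euclid_dvdM.
have p2 (w : int) : ((p ^ 2)%:Z %| w)%Z -> (p%:Z %| w)%Z.
  by apply: dvdz_trans; rewrite dvdzE /= dvdn_exp.
have p0 : p%:Z != 0 by rewrite eqz_nat -lt0n prime_gt0.
have pp2 (w : int) : ((p ^ 2)%:Z %| p%:Z * w)%Z -> (p%:Z %| w)%Z.
  by rewrite expnS expn1 PoszM dvdz_mul2l.
have pB (w w' : int) : (p%:Z %| w')%Z -> (p%:Z %| w - w')%Z -> (p%:Z %| w)%Z.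
  by move=> h; rewrite rpredBr.
have pB' (w w' : int) : (p%:Z %| w)%Z -> (p%:Z %| w - w')%Z -> (p%:Z %| w')%Z.
  by move=> h; rewrite rpredBl.
have pp : (p%:Z %| p%:Z)%Z by [].
have sq (w X Y : int) : ~~ (p%:Z %| w)%Z -> ~~ (p%:Z %| X)%Z ->
    (p%:Z %| Y ^+ 2 - w * X ^+ 2)%Z -> legendre p w = 1.
  move=> pw pXn; rewrite -Fp_intr_eq0 // rmorphB !rmorphM /= subr_eq0 -!expr2 => /eqP e.
  have X0 : X%:~R != 0 :> 'F_p by rewrite Fp_intr_eq0.
  apply: (@legendre_sqr p p_pr p_odd w (Y%:~R / X%:~R)) => //.
  by rewrite expr_div_n e mulfK // expf_neq0.
(* The precision p^2 matters here: if p divides X, then it divides Y, and after division by p also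
   Z, against primitivity. So X is a unit and w is a square mod p. *)
have one_odd (w X Y Z v' : int) : ~~ (p%:Z %| v')%Z -> ~~ (p%:Z %| w)%Z ->
    ~~ [&& p%:Z %| Y, p%:Z %| X & p%:Z %| Z]%Z ->
    ((p ^ 2)%:Z %| Y ^+ 2 - w * X ^+ 2 - v' * p%:Z * Z ^+ 2)%Z -> legendre p w = 1.
  move=> pv' pw prim h.
  have hm : (p%:Z %| Y ^+ 2 - w * X ^+ 2)%Z.
    by apply: pB (p2 _ h); rewrite !pM pp orbT.
  have [pXX|pXX] := boolP (p%:Z %| X)%Z; last exact: (sq w X Y).
  have pY : (p%:Z %| Y)%Z.
    by apply/pX/(pB _ _ _ hm); rewrite pM expr2 pM pXX !orbT.
  case/negP: prim; rewrite pY pXX /=.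
  case/dvdzP: (pXX) h => X' ->; case/dvdzP: (pY) => Y' ->.
  have -> : (Y' * p) ^+ 2 - w * (X' * p) ^+ 2 - v' * p%:Z * Z ^+ 2 =
    p%:Z * (p%:Z * (Y' ^+ 2 - w * X' ^+ 2) - v' * Z ^+ 2) by ring.
  move/pp2 => hh; have := pB' _ _ _ hh; rewrite !pM pp (negPf pv') orbb; exact.
case: (odd (valz p g)); case: (odd (valz p d));
  rewrite /= ?expn1 ?expn0 ?expr0 ?mulr1 ?mul1r ?expr1 //.
(* Both valuations are odd: p divides x, division by p leaves u y^2 + v z^2 = 0 mod p with z a unit,
   and so (u y)^2 = - u v z^2. *)
- move=> prim h.
  have px : (p%:Z %| x)%Z.
    have h1 : (p%:Z %| x ^+ 2 - u * p%:Z * y ^+ 2)%Z.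
      by apply: pB (p2 _ h); rewrite !pM pp orbT.
    by apply/pX/(pB _ _ _ h1); rewrite !pM pp orbT.
  have hm : (p%:Z %| u * y ^+ 2 + v * z ^+ 2)%Z.
    case/dvdzP: px h => x' ->.
    have -> : (x' * p) ^+ 2 - u * p%:Z * y ^+ 2 - v * p%:Z * z ^+ 2 =
      p%:Z * (p%:Z * x' ^+ 2 - (u * y ^+ 2 + v * z ^+ 2)) by ring.
    by move/pp2 => hh; apply: pB' hh; rewrite pM pp.
  have pz : ~~ (p%:Z %| z)%Z.
    apply: contra prim => pz; rewrite px pz andbT /=.
    have : (p%:Z %| u * y ^+ 2)%Z.
      by move: hm; rewrite rpredDr // pM expr2 pM pz !orbT.
    by rewrite pM (negPf pu) => /pX.
  have pN1 : ~~ (p%:Z %| -1)%Z by rewrite dvdzE /= dvdn1; have := prime_gt1 p_pr; lia.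
  rewrite -!legendreM // ?pM ?negb_or ?pN1 ?pu ?pv //.
  apply: (sq _ z (u * y)); rewrite ?pM ?negb_or ?pN1 ?pu ?pv //.
  have -> : (u * y) ^+ 2 - -1 * u * v * z ^+ 2 = u * (u * y ^+ 2 + v * z ^+ 2) by ring.
  by rewrite pM hm orbT.
- move=> prim h; apply: (one_odd v z x y u) => //.
    by rewrite [X in _ && X]andbC.
  by rewrite addrAC.
- by move=> prim h; apply: (one_odd u y x z v).
Qed.

(** * Comparison with the lines of X_1 *)

Definition pencil (K : comPzRingType) (d s t : K) (x : 'rV[K]_5) : K :=
  let x i := x 0 (inord i) in
  s * (d * (x 0%N ^+ 2 - 3%:R * x 1%N ^+ 2)
       + 6%:R * x 2%N ^+ 2 + 6%:R * x 2%N * x 3%N - 6%:R * x 3%N * x 4%N)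
  + t * (- 2%:R * d * x 0%N * x 1%N
         + x 2%N ^+ 2 - 2%:R * x 2%N * x 4%N - 3%:R * x 3%N ^+ 2 - x 4%N ^+ 2).

Lemma row5_eq0 (K : pzRingType) (x : 'rV[K]_5) :
  (forall i, (i < 5)%N -> x 0 (inord i) = 0) -> x = 0.
Proof.
by move=> h; apply/rowP => i; rewrite mxE -(h i) // inord_val.
Qed.

Lemma big_ord4 (V : nmodType) (F : 'I_4 -> V) : \sum_i F i =
  F (inord 0) + (F (inord 1) + (F (inord 2) + F (inord 3))).
Proof.
rewrite !big_ord_recl big_ord0 addr0.
by congr (F _ + (F _ + (F _ + F _))); apply: val_inj; rewrite /= inordK.
Qed.

(* The hypotheses on a, b, c say that X_1 contains a line, namely the graph of
   (u0, u1) |-> (u2, u3, u4) below: it is the trace of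
   (u0 zeta - 3 u1) / ((zeta + 1)^2 (zeta^2 + 3) sqrt zeta) times the vertex
   (zeta^2 - 3, 2 zeta, - zeta^2 - 3) of the cone of the pencil at zeta, where
   sqrt zeta = a + b zeta + c zeta^2.  It must meet, over (u2, u3, u4), the line
   contained in the quadric of the pencil of X_d. *)
Lemma pencil_line_conic (K : fieldType) (a b c d s t : K) (l : 'M[K]_(2, 5)) :
    3%:R != 0 :> K ->
    a ^+ 2 + 18%:R * b * c - 27%:R * c ^+ 2 = 0 ->
    2%:R * a * b - 6%:R * b * c + 18%:R * c ^+ 2 = 1 ->
    b ^+ 2 + 2%:R * a * c - 6%:R * b * c + 6%:R * c ^+ 2 = 0 ->
    s != 0 -> row_free l -> (forall r, pencil d s t (r *m l) = 0) ->
  exists x y z : K, (x, y, z) != (0, 0, 0) /\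
    x ^+ 2 - (t ^+ 2 + 3%:R * s ^+ 2) * y ^+ 2 - d * z ^+ 2 = 0.
Proof.
move=> n3 e1 e2 e3 s0 lfree l0.
(* The graph has a coefficient a / 3. With a = 3 [a3] the first equation becomes 3 [E1] = 0, and 3
   is cancelled. *)
pose a3 := a / 3%:R; have ea : a = 3%:R * a3 by rewrite mulrC divfK.
pose v (x y : K) (i : nat) := match i with
  | 0 => (3%:R * c - b) * x + 3%:R * c * y
  | 1 => (a3 - c) * x - b * y
  | _ => - 3%:R * c * x + a * y end.
(* Two generators of each plane, projected to (u2, u3, u4), are four vectors in a space of dimension
   3; a linear relation gives a point of each plane with the same projection. *)
pose N : 'M[K]_(4, 3) := \matrix_(i, j)
  match val i with 0%N => v 1 0 j | 1%N => v 0 1 j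
   | 2%N => - l 0 (inord (j + 2)) | _ => - l 1 (inord (j + 2)) end.
have [r r0 rN] : exists2 r : 'rV_4, r != 0 & r *m N = 0.
  have : kermx N != 0.
    by rewrite -mxrank_eq0 mxrank_ker subn_eq0 -ltnNge (leq_ltn_trans (rank_leq_col _)).
  case/rowV0Pn => r /sub_kermxP; by exists r.
pose r' : 'rV[K]_2 := \row_j r 0 (inord (j + 2)).
pose z := r' *m l.
pose x0 := r 0 (inord 0); pose x1 := r 0 (inord 1).
have zE i : z 0 i = r 0 (inord 2) * l 0 i + r 0 (inord 3) * l 1 i.
  by rewrite mxE !big_ord_recl big_ord0 addr0 !mxE /=; congr (_ * l _ _ + _ * l _ _);
     apply: val_inj.
have zv (j : nat) : (j < 3)%N -> z 0 (inord (j + 2)) = v x0 x1 j.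
  move=> j3; have := congr1 (fun M : 'rV_3 => M 0 (Ordinal j3)) rN.
  rewrite zE mxE big_ord4 !mxE /= !inordK //.
  rewrite -/x0 -/x1 => h; apply/eqP; rewrite -subr_eq0 -oppr_eq0; apply/eqP.
  rewrite -[RHS]h; case: j j3 h => [|[|[|]]] //= _ _; ring.
have z2 := zv 0%N isT; have z3 := zv 1%N isT; have z4 := zv 2%N isT.
rewrite !addnE /= in z2 z3 z4.
pose z0 := z 0 (inord 0); pose z1 := z 0 (inord 1).
have Fz := l0 r'; rewrite -/z in Fz.
pose g := t ^+ 2 + 3%:R * s ^+ 2.
(* This is s times the binary part of the form for d = 1, written as the norm of (s x - t y) + y
   sqrt g. Equal ternary parts then give [nmE]. *)
pose nm x y := (s * x - t * y) ^+ 2 - g * y ^+ 2.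
have nmE : nm x0 x1 = d * nm z0 z1.
  move: Fz; rewrite /pencil /= -/z0 -/z1 z2 z3 z4 /v => Fz.
  pose E1 := 3%:R * a3 ^+ 2 + 6%:R * b * c - 9%:R * c ^+ 2.
  have E10 : E1 = 0 by apply: (mulfI n3); rewrite mulr0 -e1 ea /E1; ring.
  pose E2 := 2%:R * a * b - 6%:R * b * c + 18%:R * c ^+ 2 - 1.
  have E20 : E2 = 0 by rewrite /E2 e2 subrr.
  pose E3 := b ^+ 2 + 2%:R * a * c - 6%:R * b * c + 6%:R * c ^+ 2.
  have E30 : E3 = 0 by [].
  apply/eqP; rewrite -subr_eq0; apply/eqP.
  set F := (X in X = 0) in Fz; transitivity
    (s * (- F + s * ((6%:R * E3 - E2) * x0 ^+ 2 + 3%:R * E2 * x1 ^+ 2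
                     + (6%:R * E3 - 6%:R * E1) * x0 * x1)
         + t * ((E3 - E1) * x0 ^+ 2 - 3%:R * (E3 + E1) * x1 ^+ 2
                + 2%:R * E2 * x0 * x1))).
    by rewrite /F /nm /g /E1 /E2 /E3 ea; ring.
  by rewrite Fz E10 E20 E30; ring.
have triv x y : (x, y) != (0, 0) -> nm x y = 0 -> exists x y z : K, (x, y, z) != (0, 0, 0) /\
    x ^+ 2 - g * y ^+ 2 - d * z ^+ 2 = 0.
  move=> xy0 nxy; exists (s * x - t * y), y, 0; split.
    apply: contraNneq xy0 => -[h y0]; move: h; rewrite y0 mulr0 subr0 => /eqP.
    by rewrite mulf_eq0 (negPf s0) => /eqP ->.
  by rewrite expr0n mulr0 subr0.
(* If both norms vanish, one of the two pairs is nonzero and the conic has a zero with last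
   coordinate 0: were both pairs zero, the common point and then the relation [r] would be
   trivial. *)
have [nz0|nz0] := eqVneq (nm z0 z1) 0.
  have [/eqP[x00 x10]|] := boolP ((x0, x1) == (0, 0)); last first.
    by move=> h; apply: triv h _; rewrite nmE nz0 mulr0.
  apply: (triv z0 z1) => //; apply/eqP => -[z00 z10].
  have z_0 : z = 0.
    apply: row5_eq0 => -[|[|[|[|[|]]]]] // _.
    - by rewrite z2 /v x00 x10; ring.
    - by rewrite z3 /v x00 x10; ring.
    - by rewrite z4 /v x00 x10; ring.
  have r'0 : r' = 0 by apply: (row_free_inj lfree); rewrite mul0mx.
  case/eqP: r0; apply/rowP => i; rewrite mxE.
  have h j : r' 0 j = 0 by rewrite r'0 mxE.
  have := h 0; have := h 1; rewrite !mxE /= => r3 r2.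
  rewrite -(inord_val i); case: i => -[|[|[|[|]]]] // _.
(* Up to the sign of sqrt g, this is the element of (x0, x1) times the conjugate of that of (z0,
   z1); its norm is [nm x0 x1 * nm z0 z1], that is d times the square of [nm z0 z1]. *)
exists ((s * x0 - t * x1) * (s * z0 - t * z1) - g * x1 * z1),
  ((s * x0 - t * x1) * z1 - (s * z0 - t * z1) * x1), (nm z0 z1); split.
  by apply: contraNneq nz0 => -[_ _ ->].
transitivity ((nm x0 x1 - d * nm z0 z1) * nm z0 z1); first by rewrite /nm /g; ring.
by rewrite nmE subrr mul0r.
Qed.

(** * Quadrics containing X_d *)

Lemma homog2_quadratic (R : comNzRingType) n (q : {mpoly R[n]}) :
    q \is 2.-homog ->
  exists M : 'I_n -> 'I_n -> R, q =
    \sum_(i < n) \sum_(j < n | (i <= j)%N) (M i j)%:MP * ('X_i * 'X_j).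
Proof.
move=> /dhomogP hq; rewrite [q]mpolyE big_seq.
elim/big_ind: _ => [|p p' [M ->] [M' ->]|m mq].
- exists (fun _ _ => 0); rewrite big1 // => i _.
  by rewrite big1 // => j _; rewrite mpolyC0 mul0r.
- exists (fun i j => M i j + M' i j); rewrite -big_split; apply: eq_bigr => i _ /=.
  by rewrite -big_split; apply: eq_bigr => j _; rewrite mpolyCD mulrDl.
have [a [b [ab em]]] : exists a b : 'I_n, (a <= b)%N /\ m = (U_(a) + U_(b))%MM.
  have m2 : mdeg m = 2%N := hq m mq.
  have [a ma] : exists a, m a != 0%N.
    apply/existsP; apply: contraT; rewrite negb_exists => /forallP h.
    have : mdeg m = 0%N by rewrite mdegE big1 // => i _; apply/eqP; have := h i; rewrite negbK.
    by rewrite m2.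
  have eqm : m = ((m - U_(a)) + U_(a))%MM by rewrite submK // lep1mP.
  have : mdeg (m - U_(a))%MM == 1%N.
    by move: m2; rewrite {1}eqm mdegD mdeg1; lia.
  move/mdeg1P => [b /eqP eb]; rewrite eb in eqm.
  case: (leqP a b) => ab; first by exists a, b; rewrite eqm addmC.
  by exists b, a; rewrite ltnW.
exists (fun i j => if (i == a) && (j == b) then q@_m else 0).
rewrite (bigD1 a) //= (bigD1 b) //= !eqxx /= em mpolyXD mul_mpolyC.
rewrite !big1 ?addr0 // => [i ia|j /andP[_ /negPf ->]].
  by rewrite big1 // => j _; rewrite (negPf ia) mpolyC0 mul0r.
by rewrite mpolyC0 mul0r.
Qed.

(* With w = x + sqrt(-3) y and w' = x - sqrt(-3) y the two equations read
   w^2 = A + sqrt(-3) B and w'^2 = A - sqrt(-3) B, so that the signs of w and w' can be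
   chosen independently. *)
Lemma conic_fibre_rigid (C : closedFieldType) (A B e l0 l1 m : C) :
    2%:R != 0 :> C -> 3%:R != 0 :> C ->
    A ^+ 2 + 3%:R * B ^+ 2 != 0 ->
    (forall x y, x ^+ 2 - 3%:R * y ^+ 2 = A -> 2%:R * x * y = B ->
       e * y ^+ 2 + l0 * x + l1 * y + m = 0) ->
  [/\ e = 0, l0 = 0, l1 = 0 & m = 0].
Proof.
move=> n2 n3 AB h.
have sqrt z : exists y : C, y ^+ 2 = z.
  have [y ey] := @solve_monicpoly C 2 (fun i => if i is 0%N then z else 0) isT.
  by exists y; rewrite ey !big_ord_recl big_ord0 /= expr0; ring.
have [om eom] := sqrt (- 3%:R).
have om0 : om != 0.
  by apply: contraNneq n3 => om0; rewrite -oppr_eq0 -eom om0 expr0n.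
have [w ew] := sqrt (A + om * B); have [w' ew'] := sqrt (A - om * B).
have /andP[w0 w0'] : (w != 0) && (w' != 0).
  rewrite -negb_or -mulf_eq0 -[_ == 0]/((0 < 2)%N && (w * w' == 0)) -expf_eq0 exprMn ew ew'.
  rewrite (_ : (A + _) * _ = A ^+ 2 - om ^+ 2 * B ^+ 2); last by ring.
  by rewrite eom mulNr opprK.
pose x s s' := (s * w + s' * w') / 2%:R.
pose y s s' := (s * w - s' * w') / (2%:R * om).
have P s s' : s ^+ 2 = 1 -> s' ^+ 2 = 1 ->
    e * y s s' ^+ 2 + l0 * x s s' + l1 * y s s' + m = 0.
  move=> s1 s1'; have yE : 3%:R * y s s' ^+ 2 = - ((s * w - s' * w') / 2%:R) ^+ 2.
    by rewrite -[3%:R]opprK -eom /y; field; rewrite om0 n2.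
  apply: h.
    rewrite yE /x; transitivity ((s ^+ 2 * w ^+ 2 + s' ^+ 2 * w' ^+ 2) / 2%:R).
      by field.
    by rewrite s1 s1' ew ew'; field.
  transitivity ((s ^+ 2 * w ^+ 2 - s' ^+ 2 * w' ^+ 2) / (2%:R * om)).
    by rewrite /x /y; field; rewrite om0 n2.
  by rewrite s1 s1' ew ew'; field; rewrite om0 n2.
have N1 : (-1) ^+ 2 = 1 :> C by rewrite sqrrN expr1n.
have P11 := P 1 1 (expr1n _ _) (expr1n _ _); have P1N := P 1 (-1) (expr1n _ _) N1.
have PN1 := P (-1) 1 N1 (expr1n _ _); have PNN := P (-1) (-1) N1 N1.
(* Signed sums of the four equations isolate the coefficients of w w', of w and of w' in turn. *)
have e0 : e = 0.
  have : e * (w * w') = 0.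
    rewrite -[RHS](mulr0 (- om ^+ 2 / 2%:R)) -[X in _ = _ * X](subrr 0).
    rewrite -{1}[0]addr0 -{1}P11 -{1}PNN -{1}[0]addr0 -{1}P1N -{1}PN1 /x /y.
    by field; rewrite om0 n2.
  by move/eqP; rewrite !mulf_eq0 (negPf w0) (negPf w0') !orbF => /eqP.
have lw : l0 + l1 / om = 0.
  have : (l0 + l1 / om) * w = 0.
    rewrite -[RHS](mulr0 (1 / 2%:R)) -[X in _ = _ * X](subrr 0).
    rewrite -{1}[0]addr0 -{1}P11 -{1}P1N -{1}[0]addr0 -{1}PN1 -{1}PNN /x /y.
    by field; rewrite om0 n2.
  by move/eqP; rewrite mulf_eq0 (negPf w0) orbF => /eqP.
have lw' : l0 - l1 / om = 0.
  have : (l0 - l1 / om) * w' = 0.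
    rewrite -[RHS](mulr0 (1 / 2%:R)) -[X in _ = _ * X](subrr 0).
    rewrite -{1}[0]addr0 -{1}P11 -{1}PN1 -{1}[0]addr0 -{1}P1N -{1}PNN /x /y.
    by field; rewrite om0 n2.
  by move/eqP; rewrite mulf_eq0 (negPf w0') orbF => /eqP.
have l00 : l0 = 0.
  apply: (mulfI n2); rewrite mulr0 -[RHS](addr0 0) -{1}lw -{1}lw'; ring.
have l10 : l1 = 0.
  move: lw; rewrite l00 add0r => /eqP; rewrite mulf_eq0 invr_eq0 (negPf om0) orbF.
  by move/eqP.
split=> //; rewrite -[RHS]P11 e0 l00 l10; ring.
Qed.

Lemma sum_ord5_pairs (V : nmodType) (F : 'I_5 -> 'I_5 -> V) :
  let G i j := F (inord i) (inord j) in
  \sum_(i < 5) \sum_(j < 5 | (i <= j)%N) F i j =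
    (G 0%N 0%N + (G 0%N 1%N + (G 0%N 2%N + (G 0%N 3%N + G 0%N 4%N))))
    + ((G 1%N 1%N + (G 1%N 2%N + (G 1%N 3%N + G 1%N 4%N)))
    + ((G 2%N 2%N + (G 2%N 3%N + G 2%N 4%N)) + ((G 3%N 3%N + G 3%N 4%N) + G 4%N 4%N))).
Proof.
move=> G; under eq_bigr => i _ do rewrite big_mkcond /=.
rewrite !big_ord_recl !big_ord0 /= !add0r !addr0 /G.
by congr ((F _ _ + (F _ _ + (F _ _ + (F _ _ + F _ _))))
    + ((F _ _ + (F _ _ + (F _ _ + F _ _)))
    + ((F _ _ + (F _ _ + F _ _)) + ((F _ _ + F _ _) + F _ _))));
  apply: val_inj; rewrite /= inordK.
Qed.

Definition row5 (K : nmodType) (a b c d e : K) : 'rV[K]_5 :=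
  \row_(i < 5) nth 0 [:: a; b; c; d; e] i.

Section Eval.
Variables (d : int) (x : 'rV[algC]_5).
Let y i := x 0 (inord i).

Lemma eval_u i : (map_mpoly ratr (u i)).@[fun i => x 0 i] = x 0 (inord i) :> algC.
Proof. by rewrite /u map_mpolyX mevalXU. Qed.

Lemma eval_Q0 : (map_mpoly ratr (Q0 d)).@[fun i => x 0 i] =
  d%:~R * (y 0%N ^+ 2 - 3%:R * y 1%N ^+ 2) + 6%:R * y 2%N ^+ 2
  + 6%:R * y 2%N * y 3%N - 6%:R * y 3%N * y 4%N :> algC.
Proof.
rewrite /Q0 !(rmorph_nat, rmorph_int, rmorphB, rmorphD, rmorphM) /= !eval_u /y; ring.
Qed.

Lemma eval_Qinf : (map_mpoly ratr (Qinf d)).@[fun i => x 0 i] =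
  - 2%:R * d%:~R * y 0%N * y 1%N + y 2%N ^+ 2 - 2%:R * y 2%N * y 4%N - 3%:R * y 3%N ^+ 2
  - y 4%N ^+ 2 :> algC.
Proof.
rewrite /Qinf !(rmorph_nat, rmorph_int, rmorphB, rmorphD, rmorphM, rmorphN) /=.
rewrite !eval_u /y; ring.
Qed.
End Eval.

(** With s and t chosen to match the coefficients of u0^2 and u0 u1, the difference q - s Q_0 - t
    Q_inf has the shape treated by [conic_fibre_rigid] on the points of X_d over a fixed (u2, u3,
    u4). This works directly with geometric points, without computing the ideal of X_d. *)
Lemma quadric_in_pencil (d : int) (q : {mpoly rat[5]}) : d != 0 -> is_quadric q ->
    (forall x, in_X d x -> in_quadric q x) ->
  exists s t : rat, (s, t) != (0, 0) /\
    forall x : 'rV[rat]_5, vanishes_at q (map_mx ratr x) -> pencil d%:~R s t x = 0.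
Proof.
move=> d0 [q0 /homog2_quadratic[M eq]] Xq.
have dq0 : d%:~R != 0 :> rat by rewrite intr_eq0.
pose c i j := M (inord i) (inord j).
pose form (K : fieldType) (f : rat -> K) (x : nat -> K) :=
  \sum_(i < 5) \sum_(j < 5 | (i <= j)%N) f (M i j) * (x i * x j).
have evq x : (map_mpoly ratr q).@[fun i => x 0 i] =
    form algC ratr (fun i => x 0 (inord i)) :> algC.
  rewrite eq (rmorph_sum (map_mpoly (@ratr algC))) (rmorph_sum (meval _)) /form.
  apply: eq_bigr => i _; rewrite (rmorph_sum (map_mpoly (@ratr algC))) (rmorph_sum (meval _)).
  apply: eq_bigr => j _; rewrite !rmorphM /= map_mpolyC !map_mpolyX mevalC !mevalXU.
  by rewrite !inord_val.
have formE K f x : form K f x = 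
   let G i j := f (c i j) * (x i * x j) in
    (G 0%N 0%N + (G 0%N 1%N + (G 0%N 2%N + (G 0%N 3%N + G 0%N 4%N))))
    + ((G 1%N 1%N + (G 1%N 2%N + (G 1%N 3%N + G 1%N 4%N)))
    + ((G 2%N 2%N + (G 2%N 3%N + G 2%N 4%N)) + ((G 3%N 3%N + G 3%N 4%N) + G 4%N 4%N))).
  by rewrite /form sum_ord5_pairs /= !inordK.
pose s := c 0%N 0%N / d%:~R; pose t := - c 0%N 1%N / (2%:R * d%:~R).
have c00 : c 0%N 0%N = s * d%:~R by rewrite /s divfK.
have c01 : c 0%N 1%N = - 2%:R * t * d%:~R by rewrite /t; field.
clearbody s t.
pose T0 (x y z : rat) := 6%:R * x ^+ 2 + 6%:R * x * y - 6%:R * y * z.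
pose Ti (x y z : rat) := x ^+ 2 - 2%:R * x * z - 3%:R * y ^+ 2 - z ^+ 2.
have key (v2 v3 v4 : rat) : T0 v2 v3 v4 ^+ 2 + 3%:R * Ti v2 v3 v4 ^+ 2 != 0 ->
  [/\ c 1%N 1%N + 3%:R * d%:~R * s = 0,
    c 0%N 2%N * v2 + c 0%N 3%N * v3 + c 0%N 4%N * v4 = 0,
    c 1%N 2%N * v2 + c 1%N 3%N * v3 + c 1%N 4%N * v4 = 0 &
    c 2%N 2%N * v2 ^+ 2 + c 2%N 3%N * v2 * v3 + c 2%N 4%N * v2 * v4
    + c 3%N 3%N * v3 ^+ 2 + c 3%N 4%N * v3 * v4 + c 4%N 4%N * v4 ^+ 2
    - s * T0 v2 v3 v4 - t * Ti v2 v3 v4 = 0].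
  move=> Tn0; set E := _ + _ * s; set L0 := (X in [/\ _, X = 0, _ & _]).
  set L1 := (X in [/\ _, _, X = 0 & _]); set m := (X in [/\ _, _, _ & X = 0]).
  have rinj (z : rat) : ratr z = 0 :> algC -> z = 0.
    by move/eqP; rewrite fmorph_eq0 => /eqP.
  have nz (n : nat) : n.+1%:R != 0 :> algC by rewrite pnatr_eq0.
  have dC0 : d%:~R != 0 :> algC by rewrite intr_eq0.
  have [] := @conic_fibre_rigid algC
    (ratr (- T0 v2 v3 v4 / d%:~R)) (ratr (Ti v2 v3 v4 / d%:~R))
    (ratr E) (ratr L0) (ratr L1) (ratr m) (nz 1%N) (nz 2%N).
  - have ratr_sum a b : ratr a ^+ 2 + 3%:R * ratr b ^+ 2
        = ratr (a ^+ 2 + 3%:R * b ^+ 2) :> algC by ring.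
    rewrite ratr_sum fmorph_eq0 !expr_div_n mulrA -mulrDl.
    by rewrite mulf_neq0 ?sqrrN ?invr_eq0 ?expf_neq0.
  - have ratr_div a : ratr (a / d%:~R) = ratr a / d%:~R :> algC.
      by rewrite fmorph_div rmorph_int.
    move=> x y; rewrite !ratr_div [ratr (- _)]rmorphN => exy1 exy2.
    have {}exy1 : d%:~R * (x ^+ 2 - 3%:R * y ^+ 2) = - ratr (T0 v2 v3 v4).
      by rewrite exy1 mulrC divfK.
    have {}exy2 : 2%:R * d%:~R * x * y = ratr (Ti v2 v3 v4).
      rewrite (_ : _ * y = d%:~R * (2%:R * x * y)); last by ring.
      by rewrite exy2 mulrC divfK.
    pose pt := row5 x y (ratr v2) (ratr v3) (ratr v4).
    have ptE i : (i < 5)%N -> pt 0 (inord i) = nth 0 [:: x; y; ratr v2; ratr v3; ratr v4] i.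
      by move=> i5; rewrite mxE inordK.
    have [_] : in_quadric q pt.
      apply: Xq; split.
      - apply: contraNneq Tn0 => pt0.
        have v0 i : (i < 5)%N -> nth 0 [:: x; y; ratr v2; ratr v3; ratr v4] i = 0.
          by move=> i5; rewrite -ptE // pt0 mxE.
        have := v0 2%N isT; have := v0 3%N isT; have := v0 4%N isT.
        move=> /= /rinj -> /rinj -> /rinj ->.
        by rewrite /T0 /Ti; apply/eqP; ring.
      - rewrite /vanishes_at eval_Q0 !ptE //= exy1 /T0; ring.
      - rewrite /vanishes_at eval_Qinf !ptE //=.
        rewrite (_ : - 2%:R * d%:~R * x * y = - (2%:R * d%:~R * x * y)); last by ring.
        by rewrite exy2 /Ti; ring.
    rewrite /vanishes_at evq formE /= !ptE //= c00 c01 => fq.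
    have h1 : d%:~R * (x ^+ 2 - 3%:R * y ^+ 2) + ratr (T0 v2 v3 v4) = 0.
      by rewrite exy1 addNr.
    have h2 : - (2%:R * d%:~R * x * y) + ratr (Ti v2 v3 v4) = 0.
      by rewrite exy2 addNr.
    set F := (X in X = 0) in fq; set H1 := (X in X = 0) in h1; set H2 := (X in X = 0) in h2.
    transitivity (F - ratr s * H1 - ratr t * H2).
      by rewrite /F /H1 /H2 /E /L0 /L1 /m; ring.
    by rewrite fq h1 h2; ring.
  by move=> /rinj ? /rinj ? /rinj ? /rinj ?.
(* The basis vectors and their pairwise sums determine a ternary quadratic form; the fibre over each
   of these six points is nondegenerate. *)
have [c11 c02 c12 c22] := key 1 0 0 isT.
have [_ c03 c13 c33] := key 0 1 0 isT.
have [_ c04 c14 c44] := key 0 0 1 isT.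
have [_ _ _ c23] := key 1 1 0 isT.
have [_ _ _ c24] := key 1 0 1 isT.
have [_ _ _ c34] := key 0 1 1 isT.
have {}c02 : c 0%N 2%N = 0 by rewrite -c02; ring.
have {}c03 : c 0%N 3%N = 0 by rewrite -c03; ring.
have {}c04 : c 0%N 4%N = 0 by rewrite -c04; ring.
have {}c12 : c 1%N 2%N = 0 by rewrite -c12; ring.
have {}c13 : c 1%N 3%N = 0 by rewrite -c13; ring.
have {}c14 : c 1%N 4%N = 0 by rewrite -c14; ring.
have {}c11 : c 1%N 1%N = - 3%:R * d%:~R * s.
  by apply/subr0_eq; rewrite -c11; ring.
have {}c22 : c 2%N 2%N = 6%:R * s + t.
  by apply/subr0_eq; rewrite -c22 /T0 /Ti; ring.
have {}c33 : c 3%N 3%N = - 3%:R * t.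
  by apply/subr0_eq; rewrite -c33 /T0 /Ti; ring.
have {}c44 : c 4%N 4%N = - t.
  by apply/subr0_eq; rewrite -c44 /T0 /Ti; ring.
have {}c23 : c 2%N 3%N = 6%:R * s.
  by apply/subr0_eq; rewrite -c23 c22 c33 /T0 /Ti; ring.
have {}c24 : c 2%N 4%N = - 2%:R * t.
  by apply/subr0_eq; rewrite -c24 c22 c44 /T0 /Ti; ring.
have {}c34 : c 3%N 4%N = - 6%:R * s.
  by apply/subr0_eq; rewrite -c34 c33 c44 /T0 /Ti; ring.
exists s, t; split.
  apply: contraNneq q0 => -[s0 t0]; rewrite eq sum_ord5_pairs /= -!/(c _ _).
  rewrite c00 c01 c02 c03 c04 c11 c12 c13 c14 c22 c23 c24 c33 c34 c44 s0 t0.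
  by rewrite !(mulr0, mul0r, oppr0, addr0, mpolyC0).
move=> x; rewrite /vanishes_at evq formE /= !mxE.
rewrite c00 c01 c02 c03 c04 c11 c12 c13 c14 c22 c23 c24 c33 c34 c44 => h.
have rinj (z : rat) : ratr z = 0 :> algC -> z = 0.
  by move/eqP; rewrite fmorph_eq0 => /eqP.
by apply: rinj; rewrite -[RHS]h /pencil; ring.
Qed.

(** * Local conditions for a rational line *)

Definition sym4 (R : nmodType) (a b c d e f g h i j : R) : 'M[R]_(2 + 2) :=
  \matrix_(k, l) nth 0 (nth [::] [:: [:: a; b; c; d]; [:: b; e; f; g];
                                  [:: c; f; h; i]; [:: d; g; i; j]] k) l.

Lemma sym4_sym (R : nmodType) (a b c d e f g h i j : R) :
  (sym4 a b c d e f g h i j)^T = sym4 a b c d e f g h i j.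
Proof.
apply/matrixP => k l; rewrite !mxE.
by case: k => -[|[|[|[|]]]] // ?; case: l => -[|[|[|[|]]]].
Qed.

Lemma det_sym4 (R : comPzRingType) (a b c d e f g h i j : R) :
  let det3 a b c d e f g h i : R :=
    a * (e * i - f * h) - b * (d * i - f * g) + c * (d * h - e * g) in
  \det (sym4 a b c d e f g h i j) =
    a * det3 e f g f h i g i j - b * det3 b f g c h i d i j
    + c * det3 b e g c f i d g j - d * det3 b e f c f h d g i.
Proof.
rewrite /=.
do 3! rewrite ?(expand_det_row _ ord0) ?big_ord_recl ?big_ord0 /cofactor.
rewrite !det_mx11 !mxE /=.
by rewrite ?mxE /= /bump /=; ring.
Qed.

Lemma sym4_quad (v : 'rV[rat]_(2 + 2)) (a b c d e f g h i j : int) :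
  let x k := v 0 (inord k : 'I_4) in
  (v *m map_mx intr (sym4 a b c d e f g h i j) *m v^T) 0 0 =
  a%:~R * x 0%N ^+ 2 + e%:~R * x 1%N ^+ 2 + h%:~R * x 2%N ^+ 2 + j%:~R * x 3%N ^+ 2
  + 2%:R * (b%:~R * x 0%N * x 1%N + c%:~R * x 0%N * x 2%N + d%:~R * x 0%N * x 3%N
     + f%:~R * x 1%N * x 2%N + g%:~R * x 1%N * x 3%N + i%:~R * x 2%N * x 3%N).
Proof.
rewrite /= mxE (@big_ord4 rat) !mxE !(@big_ord4 rat) !mxE !inordK //=; ring.
Qed.

(** Polarisation turns the identity of quadratic forms into the matrix identity of
    [plane_det_square]. The plane keeps rank 2 under [C], because a vector killed by [C] has k times
    a square equal to 0, hence is killed by [z] too. *)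
Lemma plane_quad_det_square (p : nat) (E : 'M[int]_(2 + 2)) (l : 'M[rat]_(2, 5))
    (C : 'M[rat]_(5, 2 + 2)) (z : 'cV[rat]_5) (k : int) :
    prime p -> E^T = E -> k != 0 -> odd (valz p k) -> row_free l ->
    (forall x : 'rV_5, x *m C = 0 -> x *m z = 0 -> x = 0) ->
    (forall r : 'rV_2, ((r *m l *m C) *m map_mx intr E *m (r *m l *m C)^T) 0 0
       = k%:~R * ((r *m l *m z) 0 0) ^+ 2) ->
  exists c : 'F_p, (\det E)%:~R = c ^+ 2.
Proof.
move=> p_pr Es k0 ko lf Cz h.
have kq0 : k%:~R != 0 :> rat by rewrite intr_eq0.
apply: (@plane_det_square p p_pr E (l *m C) (l *m z) k) => //.
  apply/eqP; apply: inj_row_free => r; rewrite mulmxA => rC.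
  apply: (row_free_inj lf); rewrite mul0mx; apply: Cz => //.
  apply/matrixP => i j; rewrite !ord1 [RHS]mxE; have := h r.
  rewrite rC trmx0 mulmx0 [LHS]mxE => /esym/eqP.
  by rewrite mulf_eq0 (negPf kq0) expf_eq0 => /eqP.
set Eq := map_mx intr E in h *.
pose G := (l *m C) *m Eq *m (l *m C)^T - k%:~R *: ((l *m z) *m (l *m z)^T).
suff G0 : G = 0 by apply/subr0_eq; exact: G0.
have Gsym : G^T = G.
  rewrite /G linearB linearZ /= !trmx_mul !trmxK !mulmxA.
  by rewrite /Eq map_trmx Es.
have Gr (r : 'rV[rat]_2) : (r *m G *m r^T) 0 0 = 0.
  have -> : r *m G *m r^T = (r *m l *m C) *m Eq *m (r *m l *m C)^T
      - k%:~R *: ((r *m l *m z) *m (r *m l *m z)^T).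
    by rewrite /G mulmxBr mulmxBl -scalemxAr -scalemxAl !trmx_mul !mulmxA.
  rewrite mxE h; move: (r *m l *m z) => w.
  by rewrite !mxE big_ord1 mxE -expr2 subrr.
clearbody G.
have Gexp (a b : rat) : a ^+ 2 * G 0 0 + 2%:R * a * b * G 0 1 + b ^+ 2 * G 1 1 = 0.
  have G10 : G 1 0 = G 0 1 by rewrite -{1}Gsym mxE.
  rewrite -[RHS](Gr (\row_i if val i == 0%N then a else b)) !mxE.
  rewrite !big_ord_recl !big_ord0 !mxE !big_ord_recl !big_ord0 !mxE /=.
  rewrite (_ : lift ord0 ord0 = 1); last exact: val_inj.
  by rewrite (_ : ord0 = 0) // G10; ring.
have g00 : G 0 0 = 0 by rewrite -[RHS](Gexp 1 0); ring.
have g11 : G 1 1 = 0 by rewrite -[RHS](Gexp 0 1); ring.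
have g01 : G 0 1 = 0.
  apply: (@mulfI _ 2%:R) => //; rewrite mulr0 -[RHS](Gexp 1 1) g00 g11; ring.
have g10 : G 1 0 = 0 by rewrite -Gsym mxE.
apply/matrixP => i j; rewrite [RHS]mxE.
case: i => -[|[|]] // Hi; case: j => -[|[|]] // Hj.
- by rewrite -[RHS]g00; congr (G _ _); apply: val_inj.
- by rewrite -[RHS]g01; congr (G _ _); apply: val_inj.
- by rewrite -[RHS]g10; congr (G _ _); apply: val_inj.
- by rewrite -[RHS]g11; congr (G _ _); apply: val_inj.
Qed.

Lemma row5_coords_eq0 (x : 'rV[rat]_5) : x 0 (inord 0) = 0 -> x 0 (inord 1) = 0 ->
  x 0 (inord 2) = 0 -> x 0 (inord 3) = 0 -> x 0 (inord 4) = 0 -> x = 0.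
Proof. by move=> *; apply: row5_eq0 => -[|[|[|[|[|]]]]]. Qed.

Lemma big_ord5 (V : nmodType) (F : 'I_5 -> V) : \sum_i F i =
  F (inord 0) + (F (inord 1) + (F (inord 2) + (F (inord 3) + F (inord 4)))).
Proof.
rewrite !big_ord_recl big_ord0 addr0.
by congr (F _ + (F _ + (F _ + (F _ + F _)))); apply: val_inj; rewrite /= inordK.
Qed.

Definition col5 (a b c d e : rat) : 'cV[rat]_5 := \col_(i < 5) nth 0 [:: a; b; c; d; e] i.

Lemma mul_col5 (x : 'rV[rat]_5) a b c d e : (x *m col5 a b c d e) 0 0 =
  x 0 (inord 0) * a + (x 0 (inord 1) * b + (x 0 (inord 2) * c
  + (x 0 (inord 3) * d + x 0 (inord 4) * e))).
Proof. by rewrite mxE big_ord5 !mxE !inordK. Qed.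

Definition cols4 (c0 c1 c2 c3 : 'cV[rat]_5) : 'M[rat]_(5, 2 + 2) :=
  \matrix_(i < 5, j < 4) (nth 0 [:: c0; c1; c2; c3] j) i 0.

Lemma mul_cols4 (x : 'rV[rat]_5) c0 c1 c2 c3 j : (j < 4)%N ->
  (x *m cols4 c0 c1 c2 c3) 0 (inord j : 'I_4) = (x *m nth 0 [:: c0; c1; c2; c3] j) 0 0.
Proof.
by move=> j4; rewrite !mxE; apply: eq_bigr => i _; rewrite mxE inordK.
Qed.

Lemma cols4_eq0 (x : 'rV[rat]_5) c0 c1 c2 c3 : x *m cols4 c0 c1 c2 c3 = 0 ->
  [/\ (x *m c0) 0 0 = 0, (x *m c1) 0 0 = 0, (x *m c2) 0 0 = 0 & (x *m c3) 0 0 = 0].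
Proof.
move=> h; have e j : (j < 4)%N -> (x *m nth 0 [:: c0; c1; c2; c3] j) 0 0 = 0.
  by move=> j4; rewrite -mul_cols4 // h mxE.
by split; [exact: (e 0%N)|exact: (e 1%N)|exact: (e 2%N)|exact: (e 3%N)].
Qed.

Section PencilPlane.
Variables (d s t : int) (l : 'M[rat]_(2, 5)).
Hypotheses (l_free : row_free l).
Hypothesis l0 : forall r, pencil d%:~R s%:~R t%:~R (r *m l) = 0.

(* Completing the square in u3: t Q = - 3 (t u3 - s (u2 - u4))^2 + E(u0, u1, u2, u4),
   and E has nonsquare discriminant mod 3. *)
Lemma pencil_line_t_dvd3 : ~~ (3 %| d)%Z -> (3 %| t)%Z.
Proof.
move=> d3; apply: contraT => t3.
have t0 : t%:~R != 0 :> rat by rewrite intr_eq0; apply: contraNneq t3 => ->.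
pose E := sym4 (t * d * s) (- d * t ^+ 2) 0 0 (- 3%:R * t * d * s) 0 0
  (6%:R * s * t + t ^+ 2 + 3%:R * s ^+ 2) (- t ^+ 2 - 3%:R * s ^+ 2)
  (3%:R * s ^+ 2 - t ^+ 2).
have [||||x /cols4_eq0[x0 x1 x2 x4] xz|r|c] := @plane_quad_det_square 3 E l
  (cols4 (col5 1 0 0 0 0) (col5 0 1 0 0 0) (col5 0 0 1 0 0) (col5 0 0 0 0 1))
  (col5 0 0 (- s%:~R) t%:~R s%:~R) 3 isT.
- exact: sym4_sym.
- by [].
- by [].
- by [].
- have {xz} := congr1 (fun M : 'rV_1 => M 0 0) xz.
  move: x0 x1 x2 x4; rewrite [(0 : 'rV__) _ _]mxE !mul_col5.
  rewrite !(mulr0, mulr1, addr0, add0r) => x0 x1 x2 x4.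
  rewrite x2 x4 !mul0r addr0 add0r => /eqP; rewrite mulf_eq0 (negPf t0) orbF => /eqP x3.
  exact: row5_coords_eq0.
- rewrite sym4_quad /= !mul_cols4 //= !mul_col5; apply/subr0_eq.
  transitivity (t%:~R * pencil d%:~R s%:~R t%:~R (r *m l)); last by rewrite l0 mulr0.
  by rewrite /pencil; ring.
(* Only the first term survives mod 3, where 2 is not a square. *)
have -> : \det E = 2%:R * (d * t ^+ 4) ^+ 2
    + 3%:R * (- (d ^+ 2 * t ^+ 4)
       * (6%:R * s ^+ 3 * t - 2%:R * s * t ^+ 3 - 2%:R * s ^+ 2 * t ^+ 2)
     + 2%:R * (t ^+ 2 * d ^+ 2 * s ^+ 2) * t ^+ 4
     - 3%:R * (t ^+ 2 * d ^+ 2 * s ^+ 2)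
       * (6%:R * s ^+ 3 * t - 2%:R * s * t ^+ 3 - 2%:R * s ^+ 2 * t ^+ 2)).
  by rewrite /E det_sym4 /=; ring.
have F3 (a b : int) : (2%:R * a ^+ 2 + 3%:R * b)%:~R = 2%:R * a%:~R ^+ 2 :> 'F_3.
  apply/subr0_eq; transitivity (3%:R * b%:~R : 'F_3); first by ring.
  by rewrite (_ : 3%:R = 0) ?mul0r //; apply: val_inj.
rewrite F3.
have : (d * t ^+ 4)%:~R != 0 :> 'F_3.
  by rewrite Fp_intr_eq0 // !dvdzE abszM abszX Euclid_dvdM // Euclid_dvdX // andbT negb_or d3.
move: (_ %:~R) => w; case: w => -[|[|[|]]] // ? _; case: c => -[|[|[|]]] // ?.
Qed.

(* s Q = d (s u0 - t u1)^2 - d (t^2 + 3 s^2) u1^2 + s T(u2, u3, u4). *)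
Lemma pencil_line_legendre (p : nat) : prime p -> odd p ->
    ~~ (p%:Z %| 6 * d)%Z -> coprimez s t -> odd (valz p (t ^+ 2 + 3%:R * s ^+ 2)) ->
  legendre p d = 1.
Proof.
move=> p_pr p_odd p6d st; set g := t ^+ 2 + _ => go.
have pM (w w' : int) : (p%:Z %| w * w')%Z = (p%:Z %| w)%Z || (p%:Z %| w')%Z.
  by rewrite !dvdzE abszM Euclid_dvdM.
move: p6d; rewrite (_ : 6 = 2%:R * 3%:R) // !pM !negb_or => /andP[/andP[p2 p3] pd].
have pg : (p%:Z %| g)%Z.
  by apply: contraT => /(valz_coprime p_pr) v0; rewrite v0 in go.
have p_ns : ~~ (p%:Z %| s)%Z.
  apply/negP => ps; have : (p%:Z %| t)%Z.
    have : (p%:Z %| t * t)%Z.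
      by move: pg; rewrite /g -!expr2 rpredDr // expr2 !pM ps !orbT.
    by rewrite pM orbb.
  move=> pt; have : (p%:Z %| gcdz s t)%Z by rewrite dvdz_gcd ps.
  move: st; rewrite coprimezE /coprime => /eqP st; rewrite /gcdz st dvdzE /= dvdn1.
  by have := prime_gt1 p_pr; lia.
have g0 : g != 0 by apply: contraTneq go => ->; rewrite /valz logn0.
have d0 : d != 0 by apply: contraNneq pd => ->; rewrite dvdz0.
have s0 : s%:~R != 0 :> rat by rewrite intr_eq0; apply: contraNneq p_ns => ->.
pose E := sym4 d 0 0 0 (s * (6%:R * s + t)) (s * (3%:R * s)) (s * - t)
  (s * (- 3%:R * t)) (s * (- 3%:R * s)) (s * - t).
have [||||x /cols4_eq0[xX x2 x3 x4] xz|r|c] := @plane_quad_det_square p E l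
  (cols4 (col5 s%:~R (- t%:~R) 0 0 0) (col5 0 0 1 0 0) (col5 0 0 0 1 0) (col5 0 0 0 0 1))
  (col5 0 1 0 0 0) (d * g) p_pr.
- exact: sym4_sym.
- by rewrite mulf_neq0.
- by rewrite valzM // (valz_coprime p_pr pd).
- by [].
- have {xz} := congr1 (fun M : 'rV_1 => M 0 0) xz.
  move: xX x2 x3 x4; rewrite [(0 : 'rV__) _ _]mxE !mul_col5.
  rewrite !(mulr0, mulr1, addr0, add0r) => xX x2 x3 x4 x1.
  move/eqP: xX; rewrite x1 mul0r addr0 mulf_eq0 (negPf s0) orbF => /eqP x0.
  exact: row5_coords_eq0.
- rewrite sym4_quad /= !mul_cols4 //= !mul_col5; apply/subr0_eq.
  transitivity (s%:~R * pencil d%:~R s%:~R t%:~R (r *m l)); last by rewrite l0 mulr0.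
  by rewrite /pencil /g; ring.
have F0 (w : int) : ~~ (p%:Z %| w)%Z -> w%:~R != 0 :> 'F_p by rewrite Fp_intr_eq0.
have gF : t%:~R ^+ 2 = - (3%:R * s%:~R ^+ 2) :> 'F_p.
  apply/eqP; rewrite -addr_eq0; move: pg; rewrite -Fp_intr_eq0 // => /eqP <-.
  by rewrite /g; apply/eqP; ring.
have -> : \det E = d * s ^+ 3 * (6%:R * (t ^+ 3 + 3%:R * t ^+ 2 * s + 3%:R * t * s ^+ 2
    - 9%:R * s ^+ 3)) by rewrite /E det_sym4 /=; ring.
move=> e.
(* Modulo p, t^2 = - 3 s^2 collapses the cubic to - 18 s^3, so the determinant is - 108 d s^6 = d (6
   s^2 t)^2. *)
have {}e : d%:~R * (6%:R * s%:~R ^+ 2 * t%:~R) ^+ 2 = c ^+ 2 :> 'F_p.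
  rewrite -e; transitivity (d%:~R * s%:~R ^+ 3 * (6%:R * (t%:~R * t%:~R ^+ 2
    + 3%:R * t%:~R ^+ 2 * s%:~R + 3%:R * t%:~R * s%:~R ^+ 2 - 9%:R * s%:~R ^+ 3)) : 'F_p).
    transitivity (d%:~R * 36%:R * s%:~R ^+ 4 * t%:~R ^+ 2 : 'F_p); first by ring.
    by rewrite gF; ring.
  by ring.
have w0 : 6%:R * s%:~R ^+ 2 * t%:~R != 0 :> 'F_p.
  rewrite !mulf_neq0 ?expf_neq0 ?F0 //.
    by rewrite (_ : 6%:R = (2%:R * 3%:R : int)%:~R :> 'F_p) ?F0 // pM negb_or p2.
  apply/negP => pt; move/eqP: gF; rewrite (_ : t%:~R = 0).
    rewrite expr0n eq_sym oppr_eq0 mulf_eq0 expf_eq0 (negPf (F0 _ p_ns)) orbF.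
    by apply/negP; exact: (F0 3).
  by apply/eqP; rewrite Fp_intr_eq0.
apply: (@legendre_sqr p p_pr p_odd d (c / (6%:R * s%:~R ^+ 2 * t%:~R))) => //.
by rewrite expr_div_n -e mulfK // expf_neq0.
Qed.
End PencilPlane.

(** * Proof of the theorem *)

Lemma coprime_int_ratio (s t : rat) : (s, t) != (0, 0) ->
  exists k : rat, exists s' t' : int,
    [/\ coprimez s' t', k != 0, s'%:~R = k * s & t'%:~R = k * t].
Proof.
move=> st0; pose S := numq s * denq t; pose T := numq t * denq s.
have ds0 : (denq s)%:~R != 0 :> rat by rewrite intr_eq0 denq_eq0.
have dt0 : (denq t)%:~R != 0 :> rat by rewrite intr_eq0 denq_eq0.
have g0 : gcdz S T != 0.
  rewrite gcdz_eq0 !mulf_eq0 !denq_eq0 !orbF !numq_eq0.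
  by apply: contra st0 => /andP[/eqP -> /eqP ->].
exists ((denq s)%:~R * (denq t)%:~R / (gcdz S T)%:~R).
have gq0 : (gcdz S T)%:~R != 0 :> rat by rewrite intr_eq0.
exists (S %/ gcdz S T)%Z, (T %/ gcdz S T)%Z; split.
- have h : gcdz S T = gcdz (S %/ gcdz S T)%Z (T %/ gcdz S T)%Z * `|gcdz S T|%N.
    by rewrite mulz_gcdl !divzK ?dvdz_gcdl ?dvdz_gcdr.
  by apply/eqP/(mulIf g0); rewrite mul1r [RHS]h.
- by rewrite !mulf_neq0 ?invr_eq0.
- apply: (mulIf gq0); rewrite -rmorphM /= divzK ?dvdz_gcdl // /S rmorphM /= numqE; field.
  exact: gq0.
- apply: (mulIf gq0); rewrite -rmorphM /= divzK ?dvdz_gcdr // /T rmorphM /= numqE; field.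
  exact: gq0.
Qed.

Lemma pencil_map (K : fieldType) (iota : {rmorphism rat -> K}) (d s t : rat) (x : 'rV[rat]_5) :
  pencil (iota d) (iota s) (iota t) (map_mx iota x) = iota (pencil d s t x).
Proof. by rewrite /pencil !mxE; ring. Qed.

Lemma pencil_polar (K : comPzRingType) (d s t a b : K) (x y : 'rV[K]_5) :
  pencil d s t (a *: x + b *: y) = a ^+ 2 * pencil d s t x + b ^+ 2 * pencil d s t y
    + a * b * (pencil d s t (x + y) - pencil d s t x - pencil d s t y).
Proof. by rewrite /pencil !mxE; ring. Qed.

(** A quadratic form on the plane is determined by its values at the two rows and at their sum,
    which are rational points. *)
Lemma pencil_plane_map (K : fieldType) (iota : {rmorphism rat -> K}) (d s t : rat)
    (l : 'M[rat]_(2, 5)) : (forall r, pencil d s t (r *m l) = 0) ->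
  forall r, pencil (iota d) (iota s) (iota t) (r *m map_mx iota l) = 0.
Proof.
move=> l0 r.
have mulE (r' : 'rV[K]_2) : r' *m map_mx iota l =
    r' 0 0 *: map_mx iota (row 0 l) + r' 0 1 *: map_mx iota (row 1 l).
  apply/rowP => j; rewrite !mxE !big_ord_recl big_ord0 addr0 !mxE.
  by rewrite (_ : lift ord0 ord0 = 1) //; apply: val_inj.
rewrite mulE pencil_polar -map_mxD !pencil_map.
have -> : row 0 l + row 1 l = (delta_mx 0 0 + delta_mx 0 1) *m l.
  by rewrite mulmxDl -!rowE.
by rewrite !rowE !l0 rmorph0; ring.
Qed.

(** The even powers of p in g and d are absorbed into y and z, leaving coefficients of valuation 0
    or 1, for which a primitive zero mod p^2 decides the symbol. *)
Lemma padic_hilbert_eq1 (p : prime_nat) (g d : int) (x y z : padic p) :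
    odd p -> g != 0 -> d != 0 -> (x, y, z) != (0, 0, 0) ->
    x ^+ 2 - g%:~R * y ^+ 2 - d%:~R * z ^+ 2 = 0 ->
  hilbert p g d = 1.
Proof.
move=> p_odd g0 d0 xyz0 h; have p_pr := prime_valP p.
pose sqf (a : int) := unit_part p a * (p ^ odd (valz p a))%:Z.
have aE (a : int) : a%:~R = (sqf a)%:~R * ((p ^ (valz p a)./2)%:R) ^+ 2 :> padic p.
  have e n : (p ^ n = p ^ odd n * (p ^ n./2 * p ^ n./2))%N.
    by rewrite -!expnD addnn odd_double_half.
  by rewrite {1}(unit_part_valzE p a) e /sqf !PoszM !rmorphM /= -mulrA expr2.
have pn0 n : (p ^ n)%:R != 0 :> padic p.
  by rewrite padic_natr_eq0 expn_eq0 -leqn0 leqNgt prime_gt0.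
have [||X [Y [Z [prim XYZ]]]] := @padic_conic_primitive p (sqf g) (sqf d) x
    ((p ^ (valz p g)./2)%:R * y) ((p ^ (valz p d)./2)%:R * z).
- apply: contraNneq xyz0 => -[-> /eqP + /eqP]; rewrite !mulf_eq0 !(negPf (pn0 _)).
  by move=> /eqP -> /eqP ->.
- by rewrite -[RHS]h (aE g) (aE d); ring.
exact: (@hilbert_eq1 p g d X Y Z).
Qed.

(** If s and t are both odd, their squares are 1 mod 8 and g = 4 mod 8; otherwise exactly one of
    them is odd, and so is g. *)
Lemma val2_norm (s t : int) : coprimez s t ->
  let g := t ^+ 2 + 3%:R * s ^+ 2 in ~~ (2 %| g)%Z \/ ((4 %| g)%Z /\ ~~ (8 %| g)%Z).
Proof.
move=> st /=.
have [so|se] := boolP (2 %| s)%Z; have [to|te] := boolP (2 %| t)%Z.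
- have : (2 %| gcdz s t)%Z by rewrite dvdz_gcd so.
  by rewrite (eqP st).
- left; nia.
- left; nia.
right; have [a ea] : exists a, s = 2 * a + 1 by exists (s %/ 2)%Z; lia.
have [b eb] : exists b, t = 2 * b + 1 by exists (t %/ 2)%Z; lia.
have even_succ (m : int) : exists c, m * (m + 1) = 2 * c.
  have [em|em] : m = 2 * (m %/ 2)%Z \/ m = 2 * (m %/ 2)%Z + 1 by lia.
    by exists ((m %/ 2)%Z * (m + 1)); rewrite {1}em; ring.
  by exists (m * ((m %/ 2)%Z + 1)); rewrite {2}em; ring.
have [c ec] := even_succ a; have [e ee] := even_succ b.
have -> : t ^+ 2 + 3%:R * s ^+ 2 = 4 + 8 * (e + 3 * c).
  rewrite ea eb; transitivity (4 + 4 * (b * (b + 1)) + 12 * (a * (a + 1))); first by ring.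
  by rewrite ec ee; ring.
by split; lia.
Qed.

Theorem theorem1p5 (d : int) (d_neq0 : d != 0)
    (L : fieldExtType rat) (zeta : L)
    (zeta_root : root ('X^3 + 3%:R * 'X^2 + 3%:R * 'X - 9%:R) zeta)
    (zeta_gen : <<1; zeta>>%VS = {:L}%VS)
    (d_mod12 : (d = 5 %[mod 12])%Z)
    (zeta_sq : forall p : prime_nat, ((prime_val p)%:Z %| d)%Z ->
       exists y : tensor (@padic_of_rat p) L, y ^+ 2 = tens (@padic_of_rat p) 1 zeta)
    (q : {mpoly rat[5]}) (q_quadric : is_quadric q)
    (X_sub_q : forall x, in_X d x -> in_quadric q x) :
  ~ exists2 l : 'M[rat]_(2, 5),
      is_line l & (forall x, in_line l x -> in_quadric q x).
Proof.
move=> [l l_line l_sub].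
have l_free : row_free l by rewrite /row_free l_line.
have [s0 [t0 [st0 q_pencil]]] := quadric_in_pencil d_neq0 q_quadric X_sub_q.
have [k [s [t [st k0 es et]]]] := coprime_int_ratio st0.
(* Rational points of the line suffice here; the zero vector, which is not a projective point, is
   treated apart. *)
have l0 r : pencil d%:~R s%:~R t%:~R (r *m l) = 0.
  rewrite es et; transitivity (k * pencil d%:~R s0 t0 (r *m l)).
    by rewrite /pencil; ring.
  have [->|rl0] := eqVneq (r *m l) 0; first by rewrite /pencil !mxE; ring.
  rewrite q_pencil ?mulr0 //; apply: (l_sub _ _).2; split.
    by rewrite map_mx_eq0.
  by rewrite map_mxM submxMl.
have d4 : (d %% 4)%Z = 1 by lia.
have d3 : ~~ (3 %| d)%Z by lia.
have t3 : (3 %| t)%Z := pencil_line_t_dvd3 l_free l0 d3.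
have s3 : ~~ (3 %| s)%Z.
  apply/negP => s3; have : (3 %| gcdz s t)%Z by rewrite dvdz_gcd s3.
  by rewrite (eqP st).
have s_neq0 : s != 0 by apply: contraNneq s3 => ->.
pose g := t ^+ 2 + 3%:R * s ^+ 2.
have g_gt0 : 0 < g.
  by rewrite ltr_wpDl ?sqr_ge0 // mulr_gt0 // lt_neqAle sqr_ge0 eq_sym expf_neq0.
have g_neq0 : g != 0 by rewrite gt_eqF.
have [N [gN dN prodN]] := hilbert_product g_gt0 (val2_norm st) d4.
have N3 : (3 < N)%N by lia.
have legN1 : legendre 3 d = -1.
  rewrite /legendre expr1; case: eqP => // /eqP.
  by rewrite -subr_eq0 -(rmorph1 intr) -rmorphB /= Fp_intr_eq0 //; lia.
have h3 : hilbert 3 g d = -1.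
  rewrite hilbert_coprimer // legN1; have /dvdzP[t' et'] := t3.
  have -> : g = 3 * (3 * t' ^+ 2 + s ^+ 2) by rewrite /g et'; ring.
  have n3 : ~~ (3 %| 3 * t' ^+ 2 + s ^+ 2)%Z.
    rewrite (rpredDl _ (dvdz_mulr _ (dvdzz 3))) dvdzE abszX Euclid_dvdX // andbT.
    by rewrite dvdzE in s3.
  rewrite valzM // ?(valz_coprime _ n3) //.
  by apply: contraNneq n3 => ->; rewrite dvdz0.
(* With the factor -1 at 3, the product formula is contradicted as soon as every other factor is 1,
   which is what remains to be shown. *)
move: prodN; rewrite /odd_hilbert_prod (bigD1 (Ordinal N3)) //= h3 big1 // => p.
move=> /andP[/andP[p_pr p_odd] p_neq3].
have {p_neq3} p3 : p != 3%N :> nat.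
  by apply: contraNneq p_neq3 => e; apply/eqP/val_inj.
have [pd|pd] := boolP ((p : nat)%:Z %| d)%Z; last first.
  rewrite hilbert_coprimer //; have [vo|ve] := boolP (odd (valz p g)).
    rewrite (pencil_line_legendre l_free l0 p_pr p_odd _ st vo) ?expr1n //.
    have p6 : ~~ (p %| 2 * 3)%N.
      rewrite Euclid_dvdM // !dvdn_prime2 // negb_or p3 andbT.
      by apply: contraTneq p_odd => ->.
    by rewrite dvdzE abszM Euclid_dvdM // negb_or -dvdzE pd andbT.
  by rewrite -(even_halfK ve) -mul2n exprM legendre_sqr1 // expr1n.
pose P := PrimeNat p_pr.
have [y /(tensor_sqrt_zeta zeta_root zeta_gen)[a [b [c [e1 e2 e3]]]]] := zeta_sq P pd.
have n3 : 3%:R != 0 :> padic P by rewrite padic_natr_eq0.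
have sK0 : padic_of_rat P s%:~R != 0 by rewrite fmorph_eq0 intr_eq0.
have lK_free : row_free (map_mx (padic_of_rat P) l) by rewrite row_free_map.
have lK0 := pencil_plane_map (@padic_of_rat P) l0.
have [x [y' [z [xyz0 h]]]] := pencil_line_conic n3 e1 e2 e3 sK0 lK_free lK0.
apply: (@padic_hilbert_eq1 P g d x y' z) => //.
rewrite -[RHS]h !rmorph_int; congr (_ - _ * _ - _).
by rewrite /g; ring.
Qed.
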